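(* The system $\mathrm{RCA}_0^\omega$ proves: for any $f:\mathbb{R}\to\mathbb{R}$ and $x\in\mathbb{R}$, the following are equivalent: (a) the function $f$ is net-continuous at $x$, i.e. for any net $x_d$ in $\mathbb{R}$ (indexed by a subset of Baire space) converging to $x$, the net $f(x_d)$ converges to $f(x)$; (b) $(\forall\varepsilon>0)(\exists\delta>0)(\forall y\in\mathbb{R})(|x-y|<\delta\to|f(x)-f(y)|<\varepsilon)$.
   Context: Base theory. Finite types: $0$ (natural numbers) is a type, and if $\sigma,\tau$ are types then so is $\sigma\to\tau$ (mappings from type $\sigma$ to type $\tau$ objects); $1:=0\to0$ and $n+1:=n\to0$; a superscript on a variable is its type. $L_\omega$ is the language with variables and quantifiers of all finite types, constants $0,1,<_0,+_0,\times_0,=_0$ on $\mathbb{N}$, the combinators $\Pi,\Sigma$ and a recursor constant $\mathbf{R}_0$. Equality at higher types is defined extensionally: $x=_\tau y$ iff $xz_1\dots z_k=_0yz_1\dots z_k$ for all arguments. $\mathrm{QF\text{-}AC}^{\sigma,\tau}$ is the schema $(\forall x^\sigma)(\exists y^\tau)A(x,y)\to(\exists Y^{\sigma\to\tau})(\forall x^\sigma)A(x,Y(x))$ for quantifier-free $A$ of $L_\omega$ (parameters of any type allowed). $\mathrm{RCA}_0^\omega$ is the theory in $L_\omega$ with classical logic and the axioms: $\mathbb{N}$ is an ordered semi-ring; the defining axioms of $\Pi,\Sigma$ (giving $\lambda$-abstraction); $\mathbf{R}_0(f,m,0)=m$ and $\mathbf{R}_0(f,m,n+1)=f(n,\mathbf{R}_0(f,m,n))$;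 extensionality $x=_\rho y\to\varphi(x)=_\tau\varphi(y)$ for all types $\rho,\tau$ and $\varphi^{\rho\to\tau}$; induction for quantifier-free formulas of $L_\omega$; $\mathrm{QF\text{-}AC}^{1,0}$. Reals. A real is a sequence of rationals $(q_n)$ with $|q_n-q_{n+i}|<2^{-n}$ for all $n,i$ (a type 1 object); $(q_n)=_{\mathbb{R}}(r_n)$ iff $|q_n-r_n|\le2^{-n+1}$ for all $n$. A function $\mathbb{R}\to\mathbb{R}$ is a type $1\to1$ functional mapping equal reals to equal reals. Sets. A subset $D$ of Baire space $\mathbb{N}^{\mathbb{N}}$ is given by a characteristic function $F_D^2\le1$ ($f\in D$ means $F_D(f)=1$); a binary relation $\preceq$ on $D$ is likewise given by a characteristic function of type $(1\times1)\to0$. Via coding (and extensionality with respect to $=_{\mathbb{R}}$), subsets of $\mathbb{R}$ and relations on them are included. Nets. $(D,\preceq)$ with $D\neq\emptyset$ is directed if $\preceq$ is transitive and reflexive on $D$ and for all $x,y\in D$ there is $z\in D$ with $x\preceq z$ and $y\preceq z$. A net in $\mathbb{R}$ is a map $x_d:D\to\mathbb{R}$ with $(D,\preceq)$ directed; all index sets are subsets of Baire space given by characteristic functions $F_D^2\le1$, with $\preceq$ given by a characteristic function of type $(1\times1)\to0$ (including, via coding, subsets of $\mathbb{R}$). It converges to $y$ if $(\forall\varepsilon>0)(\exists d_0\in D)(\forall e\succeq d_0)(|x_e-y|<\varepsilon)$. *)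

(* Defs.v *)
From Stdlib Require Import List.
Import ListNotations.

Set Implicit Arguments.
Unset Strict Implicit.
Unset Printing Implicit Defensive.

Declare Scope ty_scope.
Delimit Scope ty_scope with ty.
Declare Scope tm_scope.
Delimit Scope tm_scope with tm.
Declare Scope fm_scope.
Delimit Scope fm_scope with fm.

Inductive ty : Set := tN | Arr (s t : ty).
Bind Scope ty_scope with ty.
Notation "s ⟶ t" := (Arr s t) (at level 55, right associativity) : ty_scope.
Open Scope ty_scope.

Definition t1 : ty := tN ⟶ tN.
Definition t2 : ty := t1 ⟶ tN.

(** Terms and formulas are intrinsically typed and well scoped: [V s] is the
    type of variables of type [s] that may occur free, and a quantifier over
    type [r] binds the variable [new] of the enlarged family [ext V r]. *)
Inductive ext (V : ty -> Set) (r : ty) : ty -> Set :=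
| new : ext V r r
| old s : V s -> ext V r s.
Arguments new {V r}.
Arguments old {V r s} _.

Inductive no_var : ty -> Set := .

Inductive tm (V : ty -> Set) : ty -> Set :=
| Var s : V s -> tm V s
| App s t : tm V (s ⟶ t) -> tm V s -> tm V t
| Zero : tm V tN
| One : tm V tN
| Plus : tm V (tN ⟶ tN ⟶ tN)
| Times : tm V (tN ⟶ tN ⟶ tN)
| Pi s t : tm V (s ⟶ t ⟶ s)
| Sigma r s t : tm V ((r ⟶ s ⟶ t) ⟶ (r ⟶ s) ⟶ r ⟶ t)
| Rec : tm V ((tN ⟶ tN ⟶ tN) ⟶ tN ⟶ tN ⟶ tN).
Bind Scope tm_scope with tm.
Arguments Var {V s} _.
Arguments App {V s t} _ _.
Arguments Zero {V}.
Arguments One {V}.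
Arguments Plus {V}.
Arguments Times {V}.
Arguments Pi {V s t}.
Arguments Sigma {V r s t}.
Arguments Rec {V}.

Notation "t · u" := (App t u) (at level 40, left associativity) : tm_scope.
Notation "0" := Zero : tm_scope.
Notation "1" := One : tm_scope.
Notation "t + u" := (Plus · t · u)%tm : tm_scope.
Notation "t * u" := (Times · t · u)%tm : tm_scope.
Notation "2" := (1 + 1)%tm : tm_scope.

(** The logic is classical, so the other connectives and the existential
    quantifier are abbreviations. *)
Inductive fm (V : ty -> Set) : Set :=
| EqN : tm V tN -> tm V tN -> fm V
| LtN : tm V tN -> tm V tN -> fm V
| Bot : fm V
| Imp : fm V -> fm V -> fm V
| All r : fm (ext V r) -> fm V.
Bind Scope fm_scope with fm.
Arguments EqN {V} _%_tm _%_tm.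
Arguments LtN {V} _%_tm _%_tm.
Arguments Bot {V}.
Arguments All {V} r _.

Definition Neg V (A : fm V) : fm V := Imp A Bot.
Definition And V (A B : fm V) : fm V := Neg (Imp A (Neg B)).
Definition Or V (A B : fm V) : fm V := Imp (Neg A) B.
Definition Iff V (A B : fm V) : fm V := And (Imp A B) (Imp B A).
Definition Ex V r (A : fm (ext V r)) : fm V := Neg (All r (Neg A)).
Arguments Ex {V} r _.

Fixpoint quantifier_free V (A : fm V) : Prop :=
  match A with
  | EqN _ _ | LtN _ _ | Bot => True
  | Imp A B => quantifier_free A /\ quantifier_free B
  | All _ _ => False
  end.

Definition ren (V W : ty -> Set) := forall s, V s -> W s.
Definition sub (V W : ty -> Set) := forall s, V s -> tm W s.

Fixpoint tren V W (f : ren V W) s (t : tm V s) : tm W s :=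
  match t with
  | Var v => Var (f _ v)
  | App t u => App (tren f t) (tren f u)
  | Zero => Zero
  | One => One
  | Plus => Plus
  | Times => Times
  | Pi => Pi
  | Sigma => Sigma
  | Rec => Rec
  end.

Fixpoint tsub V W (f : sub V W) s (t : tm V s) : tm W s :=
  match t with
  | Var v => f _ v
  | App t u => App (tsub f t) (tsub f u)
  | Zero => Zero
  | One => One
  | Plus => Plus
  | Times => Times
  | Pi => Pi
  | Sigma => Sigma
  | Rec => Rec
  end.

Definition twk V r s (t : tm V s) : tm (ext V r) s := tren (fun _ v => old v) t.
Notation "t ↑" := (twk _ t) (at level 2, left associativity, format "t ↑").
Arguments twk {V} r {s} t.

Definition ren_up V W r (f : ren V W) : ren (ext V r) (ext W r) :=
  fun s v => match v with new => new | old v => old (f _ v) end.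

Definition scons V W r (t : tm W r) (f : sub V W) : sub (ext V r) W :=
  fun s v =>
    match v in ext _ _ s return tm W s with new => t | old v => f _ v end.

Definition sub_up V W r (f : sub V W) : sub (ext V r) (ext W r) :=
  scons (Var new) (fun _ v => (f _ v)↑).
Arguments ren_up {V W} r f s v.
Arguments sub_up {V W} r f s v.

Fixpoint fren V W (f : ren V W) (A : fm V) : fm W :=
  match A in fm _ return fm W with
  | EqN t u => EqN (tren f t) (tren f u)
  | LtN t u => LtN (tren f t) (tren f u)
  | Bot => Bot
  | Imp A B => Imp (fren f A) (fren f B)
  | All r A => All r (fren (ren_up r f) A)
  end.

Fixpoint fsub V W (f : sub V W) (A : fm V) : fm W :=
  match A in fm _ return fm W with
  | EqN t u => EqN (tsub f t) (tsub f u)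
  | LtN t u => LtN (tsub f t) (tsub f u)
  | Bot => Bot
  | Imp A B => Imp (fsub f A) (fsub f B)
  | All r A => All r (fsub (sub_up r f) A)
  end.

Definition fwk V r (A : fm V) : fm (ext V r) := fren (fun _ v => old v) A.
Arguments fwk {V} r A.

Definition inst V r (A : fm (ext V r)) (t : tm V r) : fm V :=
  fsub (scons t (fun _ v => Var v)) A.

Notation "t ≐ u" := (EqN t u) (at level 70) : fm_scope.
Notation "t ≺ u" := (LtN t u) (at level 70) : fm_scope.
Notation "A ⇒ B" := (Imp A B) (at level 90, right associativity) : fm_scope.
Notation "A ∧ B" := (And A B) (at level 80, right associativity) : fm_scope.
Notation "A ∨ B" := (Or A B) (at level 85, right associativity) : fm_scope.
Notation "A ⇔ B" := (Iff A B) (at level 95, no associativity) : fm_scope.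

(** A bound name stands for [Var new]; used below a further quantifier it must
    be weakened with [↑] (typing enforces the right number of weakenings). *)
Definition forall_ V r (A : tm (ext V r) r -> fm (ext V r)) : fm V :=
  All r (A (Var new)).
Definition exists_ V r (A : tm (ext V r) r -> fm (ext V r)) : fm V :=
  Ex r (A (Var new)).
Arguments forall_ {V} r A.
Arguments exists_ {V} r A.
Notation "∀ x : r , A" := (forall_ r (fun x => A%fm))
  (at level 99, x name, r at level 60, A at level 200) : fm_scope.
Notation "∃ x : r , A" := (exists_ r (fun x => A%fm))
  (at level 99, x name, r at level 60, A at level 200) : fm_scope.

Local Open Scope tm_scope.
Local Open Scope fm_scope.

Definition leN V (t u : tm V tN) : fm V := Neg (u ≺ t).

Fixpoint EqT V (s : ty) : tm V s -> tm V s -> fm V :=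
  match s return tm V s -> tm V s -> fm V with
  | tN => fun t u => t ≐ u
  | Arr r s' => fun t u => ∀ z : r, EqT (t↑ · z) (u↑ · z)
  end.

Inductive proves (T : forall V, fm V -> Prop) :
    forall V, list (fm V) -> fm V -> Prop :=
| P_ax V (H : list (fm V)) A : T V A -> proves T H A
| P_hyp V (H : list (fm V)) A : In A H -> proves T H A
| P_impI V (H : list (fm V)) A B : proves T (A :: H) B -> proves T H (A ⇒ B)
| P_impE V (H : list (fm V)) A B :
    proves T H (A ⇒ B) -> proves T H A -> proves T H B
| P_raa V (H : list (fm V)) A : proves T (Neg A :: H) Bot -> proves T H A
| P_allI V (H : list (fm V)) r (A : fm (ext V r)) :
    proves T (map (fwk r) H) A -> proves T H (All r A)
| P_allE V (H : list (fm V)) r (A : fm (ext V r)) (t : tm V r) :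
    proves T H (All r A) -> proves T H (inst A t)
| P_eq_refl V (H : list (fm V)) (t : tm V tN) : proves T H (t ≐ t)
| P_eq_subst V (H : list (fm V)) (A : fm (ext V tN)) (t u : tm V tN) :
    proves T H (t ≐ u) -> proves T H (inst A t) -> proves T H (inst A u).

(** Axioms are given in all contexts [V], with arbitrary terms in place of
    their universally quantified variables. *)
Inductive ordered_semiring V : fm V -> Prop :=
| OS_addA a b c : ordered_semiring (a + (b + c) ≐ (a + b) + c)
| OS_addC a b : ordered_semiring (a + b ≐ b + a)
| OS_add0 a : ordered_semiring (a + 0 ≐ a)
| OS_mulA a b c : ordered_semiring (a * (b * c) ≐ (a * b) * c)
| OS_mulC a b : ordered_semiring (a * b ≐ b * a)
| OS_mul1 a : ordered_semiring (a * 1 ≐ a)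
| OS_mul0 a : ordered_semiring (a * 0 ≐ 0)
| OS_mulD a b c : ordered_semiring (a * (b + c) ≐ a * b + a * c)
| OS_irrefl a : ordered_semiring (Neg (a ≺ a))
| OS_trans a b c : ordered_semiring (a ≺ b ⇒ b ≺ c ⇒ a ≺ c)
| OS_total a b : ordered_semiring (a ≺ b ∨ a ≐ b ∨ b ≺ a)
| OS_lt01 : ordered_semiring (0 ≺ 1)
| OS_lt_add a b c : ordered_semiring (a ≺ b ⇒ a + c ≺ b + c)
| OS_lt_mul a b c : ordered_semiring (0 ≺ c ⇒ a ≺ b ⇒ a * c ≺ b * c).

(** [A(n+1)], where [A(n)] has [n] as its distinguished variable. *)
Definition at_succ V (A : fm (ext V tN)) : fm (ext V tN) :=
  fsub (scons (Var new + 1) (fun _ v => Var (old v))) A.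

(** [A(x, Y x)], in the context of [Y] and then [x], where [A(x, y)] is in the
    context of [x] and then [y]. *)
Definition at_choice V s t (A : fm (ext (ext V s) t)) :
    fm (ext (ext V (s ⟶ t)) s) :=
  fsub (scons (Var (old new) · Var new)
         (scons (Var new) (fun _ v => Var (old (old v))))) A.

Inductive RCA0w V : fm V -> Prop :=
| RCA_semiring A : ordered_semiring A -> RCA0w A
| RCA_Pi s t (x : tm V s) (y : tm V t) : RCA0w (EqT (Pi · x · y) x)
| RCA_Sigma r s t (x : tm V (r ⟶ s ⟶ t)) (y : tm V (r ⟶ s)) (z : tm V r) :
    RCA0w (EqT (Sigma · x · y · z) (x · z · (y · z)))
| RCA_Rec0 f m : RCA0w (Rec · f · m · 0 ≐ m)
| RCA_RecS f m n : RCA0w (Rec · f · m · (n + 1) ≐ f · n · (Rec · f · m · n))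
| RCA_ext r s (x y : tm V r) (phi : tm V (r ⟶ s)) :
    RCA0w (EqT x y ⇒ EqT (phi · x) (phi · y))
| RCA_ind (A : fm (ext V tN)) : quantifier_free A ->
    RCA0w (inst A 0 ∧ All tN (A ⇒ at_succ A) ⇒ All tN A)
| RCA_QFAC (A : fm (ext (ext V t1) tN)) : quantifier_free A ->
    RCA0w (All t1 (Ex tN A) ⇒ Ex (t1 ⟶ tN) (All t1 (at_choice A))).

Definition RCA0w_proves (A : fm no_var) : Prop := proves RCA0w [] A.

(** An expression [(qpos - qneg) / qden] with natural number terms; the
    comparisons below are meant for positive denominators. *)
Record qexp V := QExp { qpos : tm V tN; qneg : tm V tN; qden : tm V tN }.

Definition qwk V r (p : qexp V) : qexp (ext V r) :=
  QExp (qpos p)↑ (qneg p)↑ (qden p)↑.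
Notation "p ⇑" := (qwk _ p) (at level 2, left associativity, format "p ⇑").
Arguments qwk {V} r p.

Definition qadd V (p q : qexp V) : qexp V :=
  QExp (qpos p * qden q + qpos q * qden p) (qneg p * qden q + qneg q * qden p)
       (qden p * qden q).
Definition qopp V (p : qexp V) : qexp V := QExp (qneg p) (qpos p) (qden p).
Definition qsub V (p q : qexp V) : qexp V := qadd p (qopp q).
Definition qlt V (p q : qexp V) : fm V :=
  qpos p * qden q + qneg q * qden p ≺ qpos q * qden p + qneg p * qden q.
Definition qle V (p q : qexp V) : fm V := Neg (qlt q p).
Definition qabs_lt V (p q : qexp V) : fm V := qlt p q ∧ qlt (qopp p) q.
Definition qabs_le V (p q : qexp V) : fm V := qle p q ∧ qle (qopp p) q.
Definition q0 V : qexp V := QExp 0 0 1.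
Arguments q0 {V}.

(** [Sigma · Plus · (Sigma · Pi · Pi)] is [λm. m + m]. *)
Definition pow2 V (n : tm V tN) : tm V tN :=
  Rec · (Pi · (Sigma · Plus · (Sigma · Pi · (Pi (t := tN))))) · 1 · n.
(** [qpow n] is [2^(-n)] and [qpow' n] is [2^(-n+1)]. *)
Definition qpow V (n : tm V tN) : qexp V := QExp 1 0 (pow2 n).
Definition qpow' V (n : tm V tN) : qexp V := QExp 2 0 (pow2 n).

Definition npair V (a b : tm V tN) : tm V tN := (a + b) * (a + b) + a.

(** The rational [(a - b) / (c + 1)] is coded by [npair (npair a b) c];
    [with_rat q A] says that [q] codes a rational that satisfies [A]. *)
Definition with_rat V (q : tm V tN)
    (A : qexp (ext (ext (ext V tN) tN) tN) -> fm (ext (ext (ext V tN) tN) tN)) :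
    fm V :=
  ∃ a : tN, ∃ b : tN, ∃ c : tN,
    q↑↑↑ ≐ npair (npair a↑↑ b↑) c ∧ A (QExp a↑↑ b↑ (c + 1)).

Definition is_real V (x : tm V t1) : fm V :=
  ∀ n : tN, ∀ i : tN,
    with_rat (x↑↑ · n↑) (fun p =>
    with_rat (x↑↑ · (n↑ + i))↑↑↑ (fun q =>
      qabs_lt (qsub p⇑⇑⇑ q) (qpow n↑↑↑↑↑↑↑))).

Definition eq_real V (x y : tm V t1) : fm V :=
  ∀ n : tN,
    with_rat (x↑ · n) (fun p =>
    with_rat (y↑ · n)↑↑↑ (fun q =>
      qabs_le (qsub p⇑⇑⇑ q) (qpow' n↑↑↑↑↑↑))).

(** On reals, [x < y] is [∃ n, x_n + 2^(-n+1) < y_n], the negation of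
    [∀ n, y_n <= x_n + 2^(-n+1)]. *)
Definition real_pos V (e : tm V t1) : fm V :=
  ∃ n : tN, with_rat (e↑ · n) (fun p => qlt (qadd q0 (qpow' n↑↑↑)) p).

(** [|x - y| < e], where [|x - y|] is the real with [n]-th term
    [|x_(n+1) - y_(n+1)|]. *)
Definition dist_lt V (x y e : tm V t1) : fm V :=
  ∃ n : tN,
    with_rat (x↑ · (n + 1)) (fun p =>
    with_rat (y↑ · (n + 1))↑↑↑ (fun q =>
    with_rat (e↑ · n)↑↑↑↑↑↑ (fun d =>
      qabs_lt (qsub p⇑⇑⇑⇑⇑⇑ q⇑⇑⇑) (qsub d (qpow' n↑↑↑↑↑↑↑↑↑))))).

Definition is_real_fun V (f : tm V (t1 ⟶ t1)) : fm V :=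
  (∀ x : t1, is_real x ⇒ is_real (f↑ · x)) ∧
  (∀ x : t1, ∀ y : t1, is_real x↑ ⇒ is_real y ⇒ eq_real x↑ y ⇒
     eq_real (f↑↑ · x↑) (f↑↑ · y)).

Definition char_set V (D : tm V t2) : fm V := ∀ x : t1, leN (D↑ · x) 1.
Definition in_set V (x : tm V t1) (D : tm V t2) : fm V := D · x ≐ 1.

Definition char_rel V (R : tm V (t1 ⟶ t1 ⟶ tN)) : fm V :=
  ∀ x : t1, ∀ y : t1, leN (R↑↑ · x↑ · y) 1.
Definition related V (R : tm V (t1 ⟶ t1 ⟶ tN)) (x y : tm V t1) : fm V :=
  R · x · y ≐ 1.

Definition directed V (D : tm V t2) (R : tm V (t1 ⟶ t1 ⟶ tN)) : fm V :=
  (∃ x : t1, in_set x D↑) ∧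
  (∀ x : t1, in_set x D↑ ⇒ related R↑ x x) ∧
  (∀ x : t1, ∀ y : t1, ∀ z : t1,
     in_set x↑↑ D↑↑↑ ⇒ in_set y↑ D↑↑↑ ⇒ in_set z D↑↑↑ ⇒
     related R↑↑↑ x↑↑ y↑ ⇒ related R↑↑↑ y↑ z ⇒ related R↑↑↑ x↑↑ z) ∧
  (∀ x : t1, ∀ y : t1, in_set x↑ D↑↑ ⇒ in_set y D↑↑ ⇒
     ∃ z : t1, in_set z D↑↑↑ ∧ related R↑↑↑ x↑↑ z ∧ related R↑↑↑ y↑ z).

Definition is_net V (D : tm V t2) (R : tm V (t1 ⟶ t1 ⟶ tN))
    (u : tm V (t1 ⟶ t1)) : fm V :=
  char_set D ∧ char_rel R ∧ directed D R ∧
  (∀ d : t1, in_set d D↑ ⇒ is_real (u↑ · d)).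

Definition net_cvg V (D : tm V t2) (R : tm V (t1 ⟶ t1 ⟶ tN))
    (u : tm V (t1 ⟶ t1)) (y : tm V t1) : fm V :=
  ∀ e : t1, is_real e ∧ real_pos e ⇒
    ∃ d0 : t1, in_set d0 D↑↑ ∧
      (∀ d : t1, in_set d D↑↑↑ ∧ related R↑↑↑ d0↑ d ⇒
         dist_lt (u↑↑↑ · d) y↑↑↑ e↑↑).

(** [λd. f (u d)] *)
Definition compose V r s t (f : tm V (s ⟶ t)) (u : tm V (r ⟶ s)) : tm V (r ⟶ t) :=
  Sigma · (Pi · f) · u.

Definition net_continuous V (f : tm V (t1 ⟶ t1)) (x : tm V t1) : fm V :=
  ∀ D : t2, ∀ R : t1 ⟶ t1 ⟶ tN, ∀ u : t1 ⟶ t1,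
    is_net D↑↑ R↑ u ⇒
    net_cvg D↑↑ R↑ u x↑↑↑ ⇒
    net_cvg D↑↑ R↑ (compose f↑↑↑ u) (f↑↑↑ · x↑↑↑).

Definition eps_delta_continuous V (f : tm V (t1 ⟶ t1)) (x : tm V t1) : fm V :=
  ∀ e : t1, is_real e ∧ real_pos e ⇒
    ∃ d : t1, is_real d ∧ real_pos d ∧
      (∀ y : t1, is_real y ⇒
         dist_lt x↑↑↑ y d↑ ⇒ dist_lt (f↑↑↑ · x↑↑↑) (f↑↑↑ · y) e↑↑).

(* Main.v *)
From HB Require Import structures.
From mathcomp Require Import all_boot all_order all_algebra boolp ring lra.
From Stdlib Require Import List Eqdep.
Require Import Defs.

(** By completeness it is enough to prove the equivalence in every model of
    [RCA0w] with extensional function spaces. The numbers of such a model form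
    an ordered semiring with subtraction, so the rationals of the model embed in
    an ordered field.

    One direction is direct. For the other, suppose that [f] is not continuous
    at [x], as witnessed by [e]. The sequences [w = (n, y)] such that [y], turned
    into a real [z], satisfies [|x_n - z_n| < 4 2^(-n)] and
    [|(f x)_(n+1) - (f z)_(n+1)| >= e_n - 3 2^(-n)] form a decidable set, which
    therefore has a characteristic function by [QF-AC^{1,0}]. Ordered by [n], it
    is directed because the order is total; the values [z] converge to [x], but
    the values [f z] stay away from [f x]. Indexing by the witnesses themselves
    avoids choosing a sequence of them, which would need [QF-AC^{0,1}]. *)

Set Implicit Arguments.
Unset Strict Implicit.
Unset Printing Implicit Defensive.

(** * Substitution *)

(** The numbers of a model may be nonstandard, and its functionals are only those that it contains.
    So each auxiliary function has to come from the combinators, the recursor or [QF-AC^{1,0}], and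
    each induction has to be on a quantifier-free formula. This shapes the index set. Being a real
    is universal over indices, [closer] is existential and its negation universal, so the natural
    conditions on a witness are not quantifier-free. Realness is therefore enforced by a functional
    of the model that sends all sequences to reals and only shifts those that are real, and each
    inequality is tested only at the precision that the index provides. The constants pay for the
    lost precision. If [|x - y| < 2^(-n)] is witnessed at place [k + 1], the way from [x_n] through
    [x_(k+1)] and [y_(k+1)] to [z_n = y_(n+1)] costs at most [1 + 1 + 1/2 < 4] times [2^(-n)]. The 3
    consists of the 2 in the definition of [<] and of 1 for the distance between the terms [n + 1]
    of the equal reals [f y] and [f z]. *)

Definition var_sub V W (f : ren V W) : sub V W := fun s v => Var (f s v).

Definition sub_comp V W X (f : sub V W) (g : sub W X) : sub V X :=
  fun s v => tsub g (f s v).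

Lemma sub_ext V W (f g : sub V W) : (forall s v, f s v = g s v) -> f = g.
Proof. by move=> fg; apply: functional_extensionality_dep => s; apply/funext => v. Qed.

Lemma tren_tsub V W (f : ren V W) s (t : tm V s) : tren f t = tsub (var_sub f) t.
Proof. by elim: t => //= s1 s2 t -> u ->. Qed.

Lemma tsub_comp V W X (f : sub V W) (g : sub W X) s (t : tm V s) :
  tsub g (tsub f t) = tsub (sub_comp f g) t.
Proof. by elim: t => //= s1 s2 t -> u ->. Qed.

Lemma tsub_id V s (t : tm V s) : tsub (fun _ v => Var v) t = t.
Proof. by elim: t => //= s1 s2 t -> u ->. Qed.

Lemma twk_tsub V r s (t : tm V s) : twk r t = tsub (var_sub (fun _ v => old v)) t.
Proof. exact: tren_tsub. Qed.

Lemma tsub_scons_wk V W r s (a : tm W r) (f : sub V W) (t : tm V s) :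
  tsub (scons a f) (twk r t) = tsub f t.
Proof. by rewrite twk_tsub tsub_comp; congr tsub; apply: sub_ext. Qed.

Lemma tsub_up_wk V W r s (f : sub V W) (t : tm V s) :
  tsub (sub_up r f) (twk r t) = twk r (tsub f t).
Proof.
rewrite /sub_up tsub_scons_wk (twk_tsub _ (tsub f t)) tsub_comp.
congr (tsub _ t); apply: sub_ext => ? ?; exact: twk_tsub.
Qed.

Lemma sub_up_var V W r (f : ren V W) :
  sub_up r (var_sub f) = var_sub (ren_up r f).
Proof. by apply: sub_ext => s [|s' v]. Qed.

Lemma sub_up_id (V : ty -> Set) r : sub_up r (fun s (v : V s) => Var v) = fun s (v : ext V
  r s) => Var v.
Proof. by apply: sub_ext => s [|s' v]. Qed.

Lemma sub_up_comp V W X r (f : sub V W) (g : sub W X) :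
  sub_comp (sub_up r f) (sub_up r g) = sub_up r (sub_comp f g).
Proof. by apply: sub_ext => s [|s' v] //=; rewrite /sub_comp /= tsub_up_wk. Qed.

Lemma scons_comp V W X r (f : sub V W) (a : tm W r) (g : sub W X) :
  sub_comp (scons a f) g = scons (tsub g a) (sub_comp f g).
Proof. by apply: sub_ext => s [|s' v]. Qed.

Lemma up_scons V W X r (f : sub V W) (a : tm X r) (g : sub W X) :
  sub_comp (sub_up r f) (scons a g) = scons a (sub_comp f g).
Proof. by apply: sub_ext => s [|s' v] //=; rewrite /sub_comp /= tsub_scons_wk. Qed.

Lemma fren_fsub V W (f : ren V W) (A : fm V) : fren f A = fsub (var_sub f) A.
Proof.
elim: A W f => //= {V} [V t u|V t u|V A IA B IB|V r A IA] W f.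
- by rewrite !tren_tsub.
- by rewrite !tren_tsub.
- by rewrite IA IB.
- by rewrite IA sub_up_var.
Qed.

Lemma fsub_comp V W X (f : sub V W) (g : sub W X) (A : fm V) :
  fsub g (fsub f A) = fsub (sub_comp f g) A.
Proof.
elim: A W X f g => //= {V} [V t u|V t u|V A IA B IB|V r A IA] W X f g.
- by rewrite !tsub_comp.
- by rewrite !tsub_comp.
- by rewrite IA IB.
- by rewrite IA sub_up_comp.
Qed.

Lemma fsub_id V (A : fm V) : fsub (fun _ v => Var v) A = A.
Proof.
elim: A => //= {V} [V t u|V t u|V A -> B ->|V r A IA] //.
- by rewrite !tsub_id.
- by rewrite !tsub_id.
- by rewrite sub_up_id IA.
Qed.

Lemma fwk_fsub V r (A : fm V) : fwk r A = fsub (var_sub (fun _ v => old v)) A.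
Proof. exact: fren_fsub. Qed.

Lemma inst_up V W r (f : sub V W) (A : fm (ext V r)) (a : tm W r) :
  inst (fsub (sub_up r f) A) a = fsub (scons a f) A.
Proof.
rewrite /inst fsub_comp up_scons; congr fsub; congr scons.
by apply: sub_ext => s v; rewrite /sub_comp tsub_id.
Qed.

Lemma fsub_inst V W r (f : sub V W) (A : fm (ext V r)) (a : tm V r) :
  fsub f (inst A a) = inst (fsub (sub_up r f) A) (tsub f a).
Proof. by rewrite inst_up /inst fsub_comp scons_comp. Qed.

Lemma fsub_up_wk V W r (f : sub V W) (A : fm V) :
  fsub (sub_up r f) (fwk r A) = fwk r (fsub f A).
Proof.
rewrite !fwk_fsub !fsub_comp; congr fsub; apply: sub_ext => s v.
by rewrite /sub_comp /= twk_tsub.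
Qed.

Lemma quantifier_free_fsub V W (f : sub V W) (A : fm V) :
  quantifier_free A -> quantifier_free (fsub f A).
Proof. by elim: A W f => //= {V} V A IA B IB W f [/IA qA /IB qB]; split. Qed.

Lemma fsub_EqT V W (f : sub V W) s (t u : tm V s) :
  fsub f (EqT t u) = EqT (tsub f t) (tsub f u).
Proof.
elim: s V W f t u => [|r _ s IH] V W f t u //=.
by rewrite /forall_ /= IH /= !tsub_up_wk.
Qed.

Lemma fsub_at_succ V W (f : sub V W) (A : fm (ext V tN)) :
  fsub (sub_up tN f) (at_succ A) = at_succ (fsub (sub_up tN f) A).
Proof.
rewrite /at_succ !fsub_comp; congr fsub; apply: sub_ext => s [|s' v] //=.
by rewrite /sub_comp /= tsub_scons_wk twk_tsub.
Qed.

Lemma fsub_at_choice V W (f : sub V W) s t (A : fm (ext (ext V s) t)) :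
  fsub (sub_up s (sub_up (s ⟶ t) f)) (at_choice A) =
  at_choice (fsub (sub_up t (sub_up s f)) A).
Proof.
rewrite /at_choice !fsub_comp; congr fsub; apply: sub_ext => r [|r' [|r'' v]] //=.
by rewrite /sub_comp /= !twk_tsub !tsub_comp; congr tsub; apply: sub_ext.
Qed.

(** * Closure of axioms and derivations under substitution *)

Lemma fsub_RCA0w V W (f : sub V W) (A : fm V) : RCA0w A -> RCA0w (fsub f A).
Proof.
case=> [B osB|s t x y|r s t x y z|g m|g m n|r s x y phi|B qB|B qB].
- apply: RCA_semiring.
  by case: osB => *; constructor.
- rewrite fsub_EqT /=; exact: RCA_Pi.
- rewrite fsub_EqT /=; exact: RCA_Sigma.
- exact: RCA_Rec0.
- exact: RCA_RecS.
- rewrite /= !fsub_EqT /=; exact: RCA_ext.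
- rewrite /= fsub_inst fsub_at_succ; apply: RCA_ind; exact: quantifier_free_fsub.
- rewrite /= fsub_at_choice; apply: RCA_QFAC; exact: quantifier_free_fsub.
Qed.

Lemma proves_weaken T V (H : list (fm V)) A :
  proves T H A -> forall H', incl H H' -> proves T H' A.
Proof.
elim=> {V H A} [V H A TA|V H A HA|V H A B _ IH|V H A B _ IA _ IB|V H A _ IH|V H r A _ IH
  |V H r A t _ IH|V H t|V H A t u _ IE _ IA] H' HH'.
- exact: P_ax.
- exact/P_hyp/HH'.
- apply/P_impI/IH => B'; case=> [<-|/HH']; [by left|by right].
- by apply: P_impE (IA _ HH') (IB _ HH').
- apply/P_raa/IH => B'; case=> [<-|/HH']; [by left|by right].
- by apply/P_allI/IH/incl_map.
- exact/P_allE/IH.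
- exact: P_eq_refl.
- exact: P_eq_subst (IE _ HH') (IA _ HH').
Qed.

(** This moves derivations between contexts: it turns a fresh variable into a bound one, and it
    replaces free variables by closed terms. *)
Lemma proves_fsub V (H : list (fm V)) A : proves RCA0w H A ->
  forall W (f : sub V W), proves RCA0w (List.map (fsub f) H) (fsub f A).
Proof.
elim=> {V H A} [V H A TA|V H A HA|V H A B _ IH|V H A B _ IA _ IB|V H A _ IH|V H r A _ IH
  |V H r A t _ IH|V H t|V H A t u _ IE _ IA] W f.
- exact/P_ax/fsub_RCA0w.
- exact/P_hyp/in_map.
- exact/P_impI/IH.
- exact: P_impE (IA _ _) (IB _ _).
- exact/P_raa/IH.
- apply: P_allI; rewrite map_map; have := IH _ (sub_up r f); rewrite map_map.
  rewrite (@map_ext _ _ (fun A => fsub (sub_up r f) (fwk r A)) (fun A => fwk r (fsub f A)))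
    // => B.
  exact: fsub_up_wk.
- by rewrite fsub_inst; apply/P_allE/IH.
- exact: P_eq_refl.
- by rewrite fsub_inst; apply: P_eq_subst (IE _ _) _; rewrite -fsub_inst.
Qed.

(** * Henkin theories *)

Definition rank_up (V : ty -> Set) r (rk : forall s, V s -> nat) s (v : ext V r s) : nat :=
  match v with new => 0%N | old s v => rk s v end.

(** Contexts may be infinite. That a term has finitely many variables is expressed through
    substitutions that agree below a bound on the rank. *)
Lemma tm_finite_support (V : ty -> Set) (rk : forall s, V s -> nat) s (t : tm V s) :
  exists k, forall W (f g : sub V W),
    (forall s v, (rk s v < k)%N -> f s v = g s v) -> tsub f t = tsub g t.
Proof.
elim: t => [r v|r r' t [k Hk] u [l Hl]|||||||]; try by exists 0%N.
  by exists (rk r v).+1 => W f g /= ->.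
exists (maxn k l) => W f g fg /=; congr App; [apply: Hk|apply: Hl] => s' v lt_v.
- by apply: fg; rewrite leq_max lt_v.
- by apply: fg; rewrite leq_max lt_v orbT.
Qed.

Lemma fm_finite_support (V : ty -> Set) (rk : forall s, V s -> nat) (A : fm V) :
  exists k, forall W (f g : sub V W),
    (forall s v, (rk s v < k)%N -> f s v = g s v) -> fsub f A = fsub g A.
Proof.
elim: A rk => {V} [V t u|V t u|V|V A IA B IB|V r A IA] rk.
- have [k Hk] := tm_finite_support rk t; have [l Hl] := tm_finite_support rk u.
  exists (maxn k l) => W f g fg /=; congr EqN; [apply: Hk|apply: Hl] => s' v lt_v;
    by apply: fg; rewrite leq_max lt_v ?orbT.
- have [k Hk] := tm_finite_support rk t; have [l Hl] := tm_finite_support rk u.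
  exists (maxn k l) => W f g fg /=; congr LtN; [apply: Hk|apply: Hl] => s' v lt_v;
    by apply: fg; rewrite leq_max lt_v ?orbT.
- by exists 0%N.
- have [k Hk] := IA rk; have [l Hl] := IB rk.
  exists (maxn k l) => W f g fg /=; congr Imp; [apply: Hk|apply: Hl] => s' v lt_v;
    by apply: fg; rewrite leq_max lt_v ?orbT.
- have [k Hk] := IA (rank_up rk).
  exists k => W f g fg /=; congr All; apply: Hk => s [|s' v] //= lt_v.
  by rewrite fg.
Qed.

(** Infinitely many variables of each type; they serve as Henkin constants. *)
Definition nat_var (_ : ty) : Set := nat.

Lemma ty_eq_dec (s t : ty) : {s = t} + {s <> t}.
Proof. decide equality. Defined.

(** The variable [c] lies beyond the supports of [L] and [B]. Sending [c] to [new] and weakening all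
    other variables turns a derivation of [B(c)] from [L] into one of [B] from the weakened [L], to
    which [P_allI] applies. *)
Lemma fresh_generalization r (L : list (fm nat_var)) (B : fm (ext nat_var r)) :
  exists c : nat_var r,
    proves RCA0w L (inst B (Var c)) -> proves RCA0w L (All r B).
Proof.
pose rk := fun (s : ty) (v : nat_var s) => v : nat.
have [k HB] := fm_finite_support (rank_up rk) B.
have [l HL] : exists l, forall A, In A L -> forall W (f g : sub nat_var W),
    (forall s v, (rk s v < l)%N -> f s v = g s v) -> fsub f A = fsub g A.
  elim: L => [|A L [l Hl]]; first by exists 0%N.
  have [m Hm] := fm_finite_support rk A.
  exists (maxn m l) => C [<-|inC] W f g fg.
    by apply: Hm => s v lt_v; apply: fg; rewrite leq_max lt_v.
  by apply: (Hl _ inC) => s v lt_v; apply: fg; rewrite leq_max lt_v orbT.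
pose c := maxn k l; exists c => LB; apply: P_allI.
(* Variables of different types can share the number [c], so the types are compared as well. *)
pose f : sub nat_var (ext nat_var r) := fun s v =>
  if (v : nat) == c then
    match ty_eq_dec r s with left e => eq_rect r (tm (ext nat_var r)) (Var new) s e
    | right _ => Var (old v) end
  else Var (old v).
have f_lt s (v : nat_var s) : (v < c)%N -> f s v = Var (old v).
  by rewrite /f; case: eqP => // ->; rewrite ltnn.
have fc : f r c = Var new.
  rewrite /f eqxx; case: ty_eq_dec => // e.
  by rewrite (Prop_irrelevance e erefl).
have := proves_fsub LB f.
rewrite fsub_inst inst_up /= fc (HB _ _ (fun s v => Var v)); last first.
  by move=> s [|s' v] //= lt_v; rewrite f_lt // leq_max lt_v.
rewrite fsub_id (@map_ext_in _ _ (fsub f) (fwk r)) // => A inA.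
rewrite fwk_fsub; apply: (HL _ inA) => s v lt_v.
by rewrite f_lt // leq_max lt_v orbT.
Qed.

(** * Countability of the set of formulas *)

Local Notation code := (GenTree.tree nat).

Fixpoint ty_code (s : ty) : code :=
  match s with
  | tN => GenTree.Leaf 0%N
  | Arr s t => GenTree.Node 0 (ty_code s :: ty_code t :: nil)
  end.

(** Types are recorded only for [Pi] and [Sigma]. The type of a variable is determined by its code,
    and that of an application by the type of the function. *)
Fixpoint tm_code (V : ty -> Set) (cV : forall s, V s -> code) s (t : tm V s) : code :=
  match t with
  | Var s v => GenTree.Node 0 (cV s v :: nil)
  | App _ _ t u => GenTree.Node 1 (tm_code cV t :: tm_code cV u :: nil)
  | Zero => GenTree.Leaf 0%N
  | One => GenTree.Leaf 1%N
  | Plus => GenTree.Leaf 2%N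
  | Times => GenTree.Leaf 3%N
  | Rec => GenTree.Leaf 4%N
  | Pi s t => GenTree.Node 2 (ty_code s :: ty_code t :: nil)
  | Sigma r s t => GenTree.Node 3 (ty_code r :: ty_code s :: ty_code t :: nil)
  end.

Definition code_up (V : ty -> Set) r (cV : forall s, V s -> code) s (v : ext V r s) : code :=
  match v with new => GenTree.Leaf 0%N | old s v => GenTree.Node 0 (cV s v :: nil) end.

Fixpoint fm_code (V : ty -> Set) (cV : forall s, V s -> code) (A : fm V) : code :=
  match A with
  | EqN t u => GenTree.Node 0 (tm_code cV t :: tm_code cV u :: nil)
  | LtN t u => GenTree.Node 1 (tm_code cV t :: tm_code cV u :: nil)
  | Bot => GenTree.Leaf 0%N
  | Imp A B => GenTree.Node 2 (fm_code cV A :: fm_code cV B :: nil)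
  | All r A => GenTree.Node 3 (ty_code r :: fm_code (code_up cV) A :: nil)
  end.

Lemma ty_code_inj (s t : ty) : ty_code s = ty_code t -> s = t.
Proof. by elim: s t => [|s IHs t IHt] [|s' t'] //= [/IHs -> /IHt ->]. Qed.

(** The conclusion is in the sigma type because equal codes must first be shown to have the same
    type. *)
Definition jointly_injective (V : ty -> Set) (c : forall s, V s -> code) :=
  forall s (v : V s) s' (v' : V s'), c s v = c s' v' -> existT V s v = existT V s' v'.

Lemma tm_code_inj (V : ty -> Set) (cV : forall s, V s -> code) :
  jointly_injective cV -> jointly_injective (tm_code cV).
Proof.
move=> inj s t; elim: t => {s} [s v|s s' t IHt u IHu|||||s s'|r s s'|] r' t';
  case: t' => //.
- move=> s0 v0 /= [e]; have E := inj _ _ _ _ e; have := projT1_eq E => /= es;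
  move: v0 {e} E; rewrite -es => v0 E.
  by rewrite (inj_pair2 _ _ _ _ _ E).
- move=> s0 s0' t0 u0 /= [et eu]; have E := IHt _ _ et; have E' := IHu _ _ eu.
  have /= [es es'] := projT1_eq E; move: t0 u0 {et eu} E E'; rewrite -es -es' => t0 u0 E E'.
  by rewrite (inj_pair2 _ _ _ _ _ E) (inj_pair2 _ _ _ _ _ E').
- by move=> s0 s0' /= [/ty_code_inj -> /ty_code_inj ->].
- by move=> r0 s0 s0' /= [/ty_code_inj -> /ty_code_inj -> /ty_code_inj ->].
Qed.

Lemma code_up_inj (V : ty -> Set) r (cV : forall s, V s -> code) :
  jointly_injective cV -> jointly_injective (@code_up V r cV).
Proof.
move=> inj s [|{}s v] s' [|{}s' v'] //= [e]; have E := inj _ _ _ _ e.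
have /= es := projT1_eq E; move: v' {e} E; rewrite -es => v' E.
by rewrite (inj_pair2 _ _ _ _ _ E).
Qed.

Lemma fm_code_inj (V : ty -> Set) (cV : forall s, V s -> code) :
  jointly_injective cV -> injective (fm_code cV).
Proof.
move=> inj A; elim: A cV inj => {V} [V t u|V t u|V|V A IA B IB|V r A IA] cV inj [t' u'|t'
  u'||A' B'|r' A'] //=.
- case=> et eu; congr EqN; apply: (@inj_pair2 _ (tm V)); exact: (tm_code_inj inj).
- case=> et eu; congr LtN; apply: (@inj_pair2 _ (tm V)); exact: (tm_code_inj inj).
- by case=> /IA -> // /IB ->.
- case=> /ty_code_inj er; move: A'; rewrite -er => A' /IA -> //.
  exact: code_up_inj.
Qed.

Lemma fm_countable : exists e : nat -> fm nat_var, forall A, exists n, e n = A.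
Proof.
pose c := fun (s : ty) (v : nat_var s) => GenTree.Node 0 (ty_code s :: GenTree.Leaf v :: nil).
have inj : injective (fun A => pickle (fm_code c A)).
  move=> A B /(pcan_inj pickleK) /fm_code_inj; apply.
  by move=> s v s' v' [/ty_code_inj es]; move: v'; rewrite -es => v' ->.
have ex n : exists B, forall A, pickle (fm_code c A) = n -> B = A.
  have [[A An]|no] := EM (exists A, pickle (fm_code c A) = n).
    by exists A => B Bn; apply: inj; rewrite An Bn.
  by exists Bot => A An; case: no; exists A.
have [e He] := choice ex.
by exists e => A; exists (pickle (fm_code c A)); apply: He.
Qed.

(** * Maximal consistent extensions with witnesses *)

Definition consistent (L : list (fm nat_var)) := ~ proves RCA0w L Bot.

Definition counterexample_in (L : list (fm nat_var)) (A : fm nat_var) :=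
  match A with
  | All r B => exists t, In (Neg (inst B t)) L
  | _ => True
  end.

(** If [A] is inconsistent with [L], then [Neg A] is consistent with it. For [A = All r B] a fresh
    [Neg B(c)] may be added too: otherwise [B(c)], and hence [All r B], would follow from
    [Neg (All r B)]. *)
Lemma consistent_extension (L : list (fm nat_var)) A : consistent L ->
  exists L', [/\ consistent L', incl L L' &
    In A L' \/ In (Neg A) L' /\ counterexample_in L' A].
Proof.
move=> conL; have [conA|] := EM (consistent (A :: L)).
  by exists (A :: L); split=> //; [exact/incl_tl/incl_refl|left; left].
move=> /contrapT inA.
have conN : consistent (Neg A :: L).
  by move=> /P_raa LA; apply/conL/(P_impE (P_impI inA) LA).
case: A inA conN => [t u|t u||A B|r B] inA conN.
1-4: by eexists; split; [exact: conN|exact/incl_tl/incl_refl|right; split=> //; left].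
have [c Hc] := fresh_generalization (Neg (All r B) :: L) B.
exists (Neg (inst B (Var c)) :: Neg (All r B) :: L); split.
- move=> /P_raa/Hc LB; apply: conN; apply: P_impE LB.
  by apply: P_hyp; left.
- by do 2 apply: incl_tl; exact: incl_refl.
- by right; split; [right; left|exists (Var c); left].
Qed.

(** All formulas are decided in turn. Deciding every formula makes implication truth-functional; the
    counterexamples reduce a universal formula to its term instances. *)
Lemma henkin_theory (L : list (fm nat_var)) : consistent L ->
  exists Th : fm nat_var -> Prop,
    [/\ forall A, In A L -> Th A,
        forall A, proves RCA0w nil A -> Th A,
        ~ Th Bot,
        forall A B, Th (Imp A B) <-> (Th A -> Th B) &
        forall r B, Th (All r B) <-> forall t, Th (inst B t)].
Proof.
move=> conL; have [e He] := fm_countable.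
have next A (K : {K | consistent K}) : {K' : {K' | consistent K'} | incl (sval K) (sval K') /\
    (In A (sval K') \/ In (Neg A) (sval K') /\ counterexample_in (sval K') A)}.
  have /cid[K' [conK' ? ?]] := consistent_extension A (svalP K).
  by exists (exist _ K' conK').
pose fix chain n := match n with
  | 0%N => exist _ L conL
  | n.+1 => sval (next (e n) (chain n)) end.
pose K n := sval (chain n).
have K_mono n m : (n <= m)%N -> incl (K n) (K m).
  elim: m => [|m IH]; first by rewrite leqn0 => /eqP ->; apply: incl_refl.
  rewrite leq_eqVlt => /orP[/eqP ->|/IH nm]; first exact: incl_refl.
  apply: incl_tran nm _; rewrite /K /=; by case: (next (e m) (chain m)) => ? [].
have decide A : exists n, In A (K n) \/ In (Neg A) (K n) /\ counterexample_in (K n) A.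
  have [n <-] := He A; exists n.+1; rewrite /K /=; by case: (next (e n) (chain n)) => ? [].
pose Th A := exists n, proves RCA0w (K n) A.
have Th_hyp n A : In A (K n) -> Th A by exists n; apply: P_hyp.
have Th_mp A B : Th (Imp A B) -> Th A -> Th B.
  move=> [n nAB] [m mA]; exists (maxn n m); apply: (@P_impE _ _ _ A).
    exact/(proves_weaken nAB)/K_mono/leq_maxl.
  exact/(proves_weaken mA)/K_mono/leq_maxr.
have Th_bot : ~ Th Bot by case=> n; apply: (svalP (chain n)).
have Th_nil A : proves RCA0w nil A -> Th A.
  by move=> pA; exists 0%N; apply: (proves_weaken pA).
have Th_all r (B : fm (ext nat_var r)) t : Th (All r B) -> Th (inst B t).
  by case=> n pB; exists n; apply: P_allE.
exists Th; split=> //.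
- by move=> A inA; apply: (Th_hyp 0%N).
- move=> A B; split; first exact: Th_mp.
  move=> AB; have [n [/Th_hyp/AB [m mB]|[/Th_hyp [m mA] _]]] := decide A.
    by exists m; apply/P_impI/(proves_weaken mB)/incl_tl/incl_refl.
  exists m; apply: P_impI; apply: P_raa; apply: (@P_impE _ _ _ A).
    by apply: (proves_weaken mA); do 2 apply/incl_tl; apply: incl_refl.
  by apply: P_hyp; right; left.
- move=> r B; split=> [AB t|AB]; first exact: Th_all.
  have [n [/Th_hyp //|[_ [t /Th_hyp nB]]]] := decide (All r B).
  by case: Th_bot; apply: Th_mp nB (AB t).
Qed.

(** * Term models and completeness *)

Section Quotient.
Variables (X : Type) (R : X -> X -> Prop).
Hypothesis Rrefl : forall x, R x x.
Hypothesis Rsym : forall x y, R x y -> R y x.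
Hypothesis Rtrans : forall x y z, R x y -> R y z -> R x z.

(** The choice depends only on the predicate [R x], so equivalent elements get equal
    representatives. Unlike equivalence classes, representatives keep the quotient of a type of
    [Set] in [Set]. *)
Definition representative x : X := sval (cid (ex_intro (R x) x (Rrefl x))).

Lemma representativeP x : R x (representative x).
Proof. by rewrite /representative; case: cid. Qed.

Lemma eq_representative x y : R x y -> representative x = representative y.
Proof.
move=> xy; rewrite /representative.
have E : R x = R y.
  by apply/funext => z; apply/propext; split; [apply: Rtrans; apply: Rsym|apply: Rtrans].
move: (ex_intro (R x) x (Rrefl x)) (ex_intro (R y) y (Rrefl y)).
by rewrite E => h h'; rewrite (Prop_irrelevance h h').
Qed.

Local Notation quotient := {x | representative x = x}.

Definition class_of x : quotient :=
  exist _ (representative x) (esym (eq_representative (representativeP x))).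

Lemma class_ofP x y : class_of x = class_of y <-> R x y.
Proof.
split=> [[E]|/eq_representative E].
  by apply: Rtrans (representativeP x) _; rewrite E; apply: Rsym (representativeP y).
by apply: eq_exist.
Qed.

Lemma class_of_sval (q : quotient) : class_of (sval q) = q.
Proof. by case: q => x xP; apply: eq_exist. Qed.

Lemma sval_class_of x : R (sval (class_of x)) x.
Proof. exact/Rsym/representativeP. Qed.
End Quotient.

(** * Structures and satisfaction *)

(** The domains are in [Set] so that the family [dom] can itself serve as a context of variables. *)
Record structure := Structure {
  dom : ty -> Set;
  ap : forall s t, dom (s ⟶ t) -> dom s -> dom t;
  zeroM : dom tN;
  oneM : dom tN;
  plusM : dom (tN ⟶ tN ⟶ tN);
  timesM : dom (tN ⟶ tN ⟶ tN);
  PiM : forall s t, dom (s ⟶ t ⟶ s);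
  SigmaM : forall r s t, dom ((r ⟶ s ⟶ t) ⟶ (r ⟶ s) ⟶ r ⟶ t);
  RecM : dom ((tN ⟶ tN ⟶ tN) ⟶ tN ⟶ tN ⟶ tN);
  ltM : dom tN -> dom tN -> Prop
}.

Section Satisfaction.
Variable M : structure.

Definition env (V : ty -> Set) := forall s, V s -> dom M s.

Definition push V r (m : dom M r) (rho : env V) : env (ext V r) :=
  fun s v => match v in ext _ _ s return dom M s with new => m | old _ v => rho _ v end.

Fixpoint eval V (rho : env V) s (t : tm V s) : dom M s :=
  match t in tm _ s return dom M s with
  | Var _ v => rho _ v
  | App _ _ t u => ap (eval rho t) (eval rho u)
  | Zero => zeroM M
  | One => oneM M
  | Plus => plusM M
  | Times => timesM M
  | Pi s t => PiM M s t
  | Sigma r s t => SigmaM M r s t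
  | Rec => RecM M
  end.

Fixpoint sat V (rho : env V) (A : fm V) : Prop :=
  match A with
  | EqN t u => eval rho t = eval rho u
  | LtN t u => ltM (eval rho t) (eval rho u)
  | Bot => False
  | Imp A B => sat rho A -> sat rho B
  | All r A => forall m, sat (push m rho) A
  end.

Record model_axioms := ModelAxioms {
  ap_ext : forall s t (f g : dom M (s ⟶ t)), (forall z, ap f z = ap g z) -> f = g;
  sat_RCA0w : forall V (rho : env V) (A : fm V), RCA0w A -> sat rho A
}.
End Satisfaction.

Arguments PiM {_ s t}.
Arguments SigmaM {_ r s t}.

Section TermModel.
Variable Th : fm nat_var -> Prop.
Hypothesis Th_proves : forall A, proves RCA0w nil A -> Th A.
Hypothesis Th_Bot : ~ Th Bot.
Hypothesis Th_Imp : forall A B, Th (Imp A B) <-> (Th A -> Th B).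
Hypothesis Th_All : forall r B, Th (All r B) <-> forall t, Th (inst B t).

Definition Th_eq s (t u : tm nat_var s) : Prop := Th (EqT t u).

(** By the Henkin property, terms that agree on all argument terms are equal in [Th]; this makes the
    term model extensional. *)
Lemma Th_EqT_arr r s (t u : tm nat_var (r ⟶ s)) :
  Th_eq t u <-> forall z, Th_eq (App t z) (App u z).
Proof.
rewrite /Th_eq /= Th_All; split=> tu z; move: (tu z).
  by rewrite /inst fsub_EqT /= !tsub_scons_wk !tsub_id.
by rewrite /inst fsub_EqT /= !tsub_scons_wk !tsub_id.
Qed.

Lemma Th_subst (A : fm (ext nat_var tN)) (t u : tm nat_var tN) :
  Th_eq t u -> Th (inst A t) -> Th (inst A u).
Proof.
move=> tu; rewrite -Th_Imp; move: tu; rewrite /Th_eq /= -Th_Imp; apply: Th_proves.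
do 2 apply: P_impI; apply: (P_eq_subst (t := t)); apply: P_hyp; [by right; left|by left].
Qed.

Lemma Th_eq_refl s (t : tm nat_var s) : Th_eq t t.
Proof.
elim: s t => [|r _ s IH] t; last by apply/Th_EqT_arr.
exact/Th_proves/P_eq_refl.
Qed.

Lemma Th_eq_sym s (t u : tm nat_var s) : Th_eq t u -> Th_eq u t.
Proof.
elim: s t u => [|r _ s IH] t u; last by move=> /Th_EqT_arr tu; apply/Th_EqT_arr => z;
  apply: IH.
move=> /(Th_subst (A := EqN (Var new) (twk tN t))).
rewrite /inst /= !tsub_scons_wk !tsub_id; apply; exact: (Th_eq_refl t).
Qed.

Lemma Th_eq_trans s (t u v : tm nat_var s) : Th_eq t u -> Th_eq u v -> Th_eq t v.
Proof.
elim: s t u v => [|r _ s IH] t u v.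
  move=> tu /(Th_subst (A := EqN (twk tN t) (Var new))).
  by rewrite /inst /= !tsub_scons_wk !tsub_id; apply.
by move=> /Th_EqT_arr tu /Th_EqT_arr uv; apply/Th_EqT_arr => z; apply: IH (tu z) (uv z).
Qed.

(** The extensionality axiom of the theory makes application well defined on classes. *)
Lemma Th_eq_ap s t (f g : tm nat_var (s ⟶ t)) x y :
  Th_eq f g -> Th_eq x y -> Th_eq (App f x) (App g y).
Proof.
move=> /Th_EqT_arr fg xy; apply: Th_eq_trans (fg x) _.
move: xy; apply/Th_Imp/Th_proves/P_ax; exact: RCA_ext.
Qed.

Lemma Th_lt (t t' u u' : tm nat_var tN) :
  Th_eq t t' -> Th_eq u u' -> Th (LtN t u) -> Th (LtN t' u').
Proof.
move=> /(Th_subst (A := LtN (Var new) (twk tN u))) + /(Th_subst (A :=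
  LtN (twk tN t') (Var new))).
by rewrite /inst /= !tsub_scons_wk !tsub_id => E E' /E /E'.
Qed.

Definition class s (t : tm nat_var s) := class_of (@Th_eq_refl s) (@Th_eq_sym s)
  (@Th_eq_trans s) t.

Lemma classP s (t u : tm nat_var s) : class t = class u <-> Th_eq t u.
Proof. exact: class_ofP. Qed.

Definition term_model : structure := {|
  dom := fun s => {t | representative (@Th_eq_refl s) t = t};
  ap := fun s t f x => class (App (sval f) (sval x));
  zeroM := class Zero;
  oneM := class One;
  plusM := class Plus;
  timesM := class Times;
  PiM := fun s t => class Pi;
  SigmaM := fun r s t => class Sigma;
  RecM := class Rec;
  ltM := fun x y => Th (LtN (sval x) (sval y))
|}.

Lemma class_sval s (x : dom term_model s) : class (sval x) = x.
Proof. exact: class_of_sval. Qed.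

Lemma sval_class s (t : tm nat_var s) : Th_eq (sval (class t)) t.
Proof. exact: sval_class_of. Qed.

Lemma ap_class s t (f : tm nat_var (s ⟶ t)) (x : tm nat_var s) :
  @ap term_model _ _ (class f) (class x) = class (App f x).
Proof. by apply/classP/Th_eq_ap; apply: sval_class. Qed.

Lemma eval_class V (f : sub V nat_var) s (t : tm V s) :
  @eval term_model _ (fun s v => class (f s v)) s t = class (tsub f t).
Proof. by elim: t => // r r' t IHt u IHu; rewrite -[RHS]ap_class -IHt -IHu. Qed.

Lemma push_class V (f : sub V nat_var) r (t : tm nat_var r) :
  @push term_model _ _ (class t) (fun s v => class (f s v)) =
  fun s (v : ext V r s) => class (scons t f v).
Proof. by apply: functional_extensionality_dep => s; apply/funext => -[]. Qed.

(** The truth lemma. At a quantifier, every element of the domain is the class of a term. *)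
Lemma sat_class V (f : sub V nat_var) (A : fm V) :
  @sat term_model _ (fun s v => class (f s v)) A <-> Th (fsub f A).
Proof.
elim: A f => {V} [V t u|V t u|V|V A IA B IB|V r A IA] f /=.
- by rewrite !eval_class classP.
- rewrite !eval_class; split; apply: Th_lt; (apply: sval_class || apply/Th_eq_sym/sval_class).
- by split.
- by rewrite Th_Imp IA IB.
- rewrite Th_All; split=> [sA t|tA m].
    by rewrite inst_up -IA -push_class.
  by rewrite -(class_sval m) push_class IA -inst_up.
Qed.

Lemma term_model_axioms : model_axioms term_model.
Proof.
split=> [s t f g fg|V rho A axA].
  rewrite -(class_sval f) -(class_sval g); apply/classP/Th_EqT_arr => z.
  by apply/classP; rewrite -!ap_class !class_sval.
have -> : rho = fun s v => class (sval (rho s v)).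
  by apply: functional_extensionality_dep => s; apply/funext => v; rewrite class_sval.
by apply/sat_class/Th_proves/P_ax/fsub_RCA0w.
Qed.
End TermModel.

Definition no_env M : env M no_var := fun s v => match v with end.

(** Every type has a closed term, so a derivation with free variables from a closed formula can be
    made closed again. *)
Fixpoint closed_tm s : tm no_var s :=
  match s with tN => Zero | Arr _ t => App Pi (closed_tm t) end.

Theorem completeness (A : fm no_var) :
  (forall M, model_axioms M -> sat (no_env M) A) -> RCA0w_proves A.
Proof.
move=> modA; apply: contrapT => notA.
pose e : sub no_var nat_var := fun s v => match v with end.
have /henkin_theory[Th [ThA Th1 Th2 Th3 Th4]] : consistent (Neg (fsub e A) :: nil).
  move=> /proves_fsub/(_ _ (fun s _ => closed_tm s)) /=; rewrite fsub_comp.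
  by rewrite (_ : sub_comp _ _ = fun s v => Var v) ?fsub_id; [move/P_raa|apply: sub_ext].
have := modA _ (term_model_axioms Th1 Th2 Th3 Th4).
have -> : no_env (term_model Th1 Th3 Th4) = fun s v => class Th1 Th3 Th4 (e s v).
  by apply: functional_extensionality_dep => s; apply/funext; case.
rewrite sat_class // => ThA'; apply: Th2; apply: (iffLR (Th3 _ _)) ThA'.
by apply: ThA; left.
Qed.

(** * Fractions over an ordered semiring with subtraction *)

Import Order.TTheory GRing.Theory Num.Theory.
Local Open Scope ring_scope.

(** Ordered rings with negative elements also satisfy the axioms of an ordered semiring. The last
    two fields exclude them and describe the nonnegative part of a discretely ordered ring. *)
Record discrete_semiring := DiscreteSemiring {
  ds_sort :> comNzSemiRingType;
  dlt : ds_sort -> ds_sort -> Prop;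
  dlt_irr : forall a, ~ dlt a a;
  dlt_trans : forall a b c, dlt a b -> dlt b c -> dlt a c;
  dlt_total : forall a b, [\/ dlt a b, a = b | dlt b a];
  dlt_add : forall a b c, dlt a b -> dlt (a + c) (b + c);
  dlt_mul : forall a b c, dlt 0 c -> dlt a b -> dlt (a * c) (b * c);
  dlt_succ : forall a, dlt 0 (a + 1);
  dlt_sub : forall a b, dlt a b -> exists d, b = a + (d + 1)
}.

Section Fractions.
Variable N : discrete_semiring.
Implicit Types a b c d : N.

Lemma dlt_addr a d : dlt a (a + (d + 1)).
Proof. by have := dlt_add a (dlt_succ d); rewrite add0r addrC. Qed.

Lemma not_dlt_addr a d : ~ dlt (a + d) a.
Proof.
move=> /dlt_sub[e E]; apply: (dlt_irr (d := N) (a := a)).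
by rewrite {2}E -addrA (addrA d); apply: dlt_addr.
Qed.

Lemma not_dltP a b : ~ dlt a b <-> exists d, a = b + d.
Proof.
split=> [nab|[d ->]]; last exact: not_dlt_addr.
have [//|->|/dlt_sub[d ->]] := dlt_total a b; first by exists 0; rewrite addr0.
by exists (d + 1).
Qed.

Lemma ds_addI a b c : a + c = b + c -> a = b.
Proof.
move=> E; have [/(@dlt_add N _ _ c)|//|/(@dlt_add N _ _ c)] := dlt_total a b;
  by rewrite E => /dlt_irr.
Qed.

Lemma ds_mulI a b c : a * (c + 1) = b * (c + 1) -> a = b.
Proof.
move=> E; have := dlt_succ c.
by have [L|//|L] := dlt_total a b => /dlt_mul/(_ L); rewrite E => /dlt_irr.
Qed.

(** [(a, b, c)] stands for [(a - b) / (c + 1)]. *)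
Definition prefrac : Type := (ds_sort N * ds_sort N * ds_sort N)%type.
Implicit Types t u v : prefrac.

Definition frac_eq t u :=
  let: (a, b, c) := t in let: (a', b', c') := u in
  a * (c' + 1) + b' * (c + 1) = a' * (c + 1) + b * (c' + 1).

Lemma frac_eq_refl t : frac_eq t t.
Proof. by case: t => [[a b] c]. Qed.

Lemma frac_eq_sym t u : frac_eq t u -> frac_eq u t.
Proof. by case: t u => [[a b] c] [[a' b'] c'] /= ->. Qed.

Lemma frac_eq_trans t u v : frac_eq t u -> frac_eq u v -> frac_eq t v.
Proof.
case: t u v => [[a b] c] [[a' b'] c'] [[x y] z] /= E E'.
(* Cancellation replaces subtraction and division: multiplied by the middle denominator and with two
   terms added, the claim is a combination of the hypotheses. *)
apply: (@ds_mulI _ _ c'); apply: (@ds_addI _ _ (b' * (c + 1) * (z + 1) + a' * (c + 1) * (z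
  + 1))).
transitivity ((a * (c' + 1) + b' * (c + 1)) * (z + 1) + (a' * (z + 1) + y * (c' + 1)) * (c
  + 1)).
  by ring.
by rewrite E E'; ring.
Qed.

Definition fraction := {t | representative frac_eq_refl t = t}.

Definition frac t : fraction := class_of frac_eq_refl frac_eq_sym frac_eq_trans t.

Lemma fracP t u : frac t = frac u <-> frac_eq t u.
Proof. exact: class_ofP. Qed.

Lemma frac_ind (P : fraction -> Prop) : (forall a b c, P (frac (a, b, c))) -> forall x, P x.
Proof. by move=> H x; rewrite -(class_of_sval frac_eq_sym frac_eq_trans x);
  case: (sval x) => [[]]. Qed.

Lemma sval_frac t : frac_eq (sval (frac t)) t.
Proof. exact: sval_class_of. Qed.

(** The last component is [(c + 1) * (c' + 1)] less one, as denominators are stored without their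
    final successor. *)
Definition prefrac_add t u : prefrac :=
  let: (a, b, c) := t in let: (a', b', c') := u in
  (a * (c' + 1) + a' * (c + 1), b * (c' + 1) + b' * (c + 1), c * c' + c + c').
Definition prefrac_mul t u : prefrac :=
  let: (a, b, c) := t in let: (a', b', c') := u in
  (a * a' + b * b', a * b' + b * a', c * c' + c + c').
Definition prefrac_opp t : prefrac := let: (a, b, c) := t in (b, a, c).

Definition frac_add (x y : fraction) := frac (prefrac_add (sval x) (sval y)).
Definition frac_mul (x y : fraction) := frac (prefrac_mul (sval x) (sval y)).
Definition frac_opp (x : fraction) := frac (prefrac_opp (sval x)).

Lemma frac_addE t u : frac_add (frac t) (frac u) = frac (prefrac_add t u).
Proof.
apply/fracP; move: (sval_frac t) (sval_frac u).
move: t u (sval (frac t)) (sval (frac u)) => [[a' b'] c'] [[x' y'] z'] [[a b] c] [[x y] z]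
  /= E E'.
transitivity ((a * (c' + 1) + b' * (c + 1)) * (z + 1) * (z' + 1) +
  (x * (z' + 1) + y' * (z + 1)) * (c + 1) * (c' + 1)); first by ring.
by rewrite E E'; ring.
Qed.

Lemma frac_mulE t u : frac_mul (frac t) (frac u) = frac (prefrac_mul t u).
Proof.
apply/fracP; move: (sval_frac t) (sval_frac u).
move: t u (sval (frac t)) (sval (frac u)) => t u T U.
have step T' T'' U' : frac_eq T' T'' -> frac_eq (prefrac_mul T' U') (prefrac_mul T'' U').
  move: T' T'' U' => [[a b] c] [[a' b'] c'] [[x y] z] /= E.
  transitivity ((a * (c' + 1) + b' * (c + 1)) * x * (z + 1) +
    (a' * (c + 1) + b * (c' + 1)) * y * (z + 1)); first by ring.
  transitivity ((a' * (c + 1) + b * (c' + 1)) * x * (z + 1) +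
    (a * (c' + 1) + b' * (c + 1)) * y * (z + 1)); first by rewrite E.
  by ring.
have comm T' U' : prefrac_mul T' U' = prefrac_mul U' T'.
  move: T' U' => [[a b] c] [[x y] z] /=; congr (_, _, _); ring.
move=> /step E /step E'; apply: frac_eq_trans (E _) _.
by rewrite (comm t) (comm t); apply: E'.
Qed.

Lemma frac_oppE t : frac_opp (frac t) = frac (prefrac_opp t).
Proof.
apply/fracP; move: (sval_frac t); move: t (sval (frac t)) => [[a' b'] c'] [[a b] c] /= E.
by rewrite addrC -E addrC.
Qed.

Definition frac0 := frac (0, 0, 0).
Definition frac1 := frac (1, 0, 0).

Lemma frac_addA : associative frac_add.
Proof.
elim/frac_ind=> a b c; elim/frac_ind=> a' b' c'; elim/frac_ind=> x y z.
rewrite !frac_addE; congr frac; congr (_, _, _); ring.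
Qed.

Lemma frac_addC : commutative frac_add.
Proof.
elim/frac_ind=> a b c; elim/frac_ind=> a' b' c'.
rewrite !frac_addE; congr frac; congr (_, _, _); ring.
Qed.

Lemma frac_add0 : left_id frac0 frac_add.
Proof.
elim/frac_ind=> a b c; rewrite !frac_addE; congr frac; congr (_, _, _); ring.
Qed.

Lemma frac_addN : left_inverse frac0 frac_opp frac_add.
Proof.
elim/frac_ind=> a b c; rewrite frac_oppE frac_addE; apply/fracP => /=; ring.
Qed.

HB.instance Definition _ := gen_eqMixin fraction.
HB.instance Definition _ := gen_choiceMixin fraction.
HB.instance Definition _ :=
  GRing.isZmodule.Build fraction frac_addA frac_addC frac_add0 frac_addN.

Lemma frac_mulA : associative frac_mul.
Proof.
elim/frac_ind=> a b c; elim/frac_ind=> a' b' c'; elim/frac_ind=> x y z.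
rewrite !frac_mulE; congr frac; congr (_, _, _); ring.
Qed.

Lemma frac_mulC : commutative frac_mul.
Proof.
elim/frac_ind=> a b c; elim/frac_ind=> a' b' c'.
rewrite !frac_mulE; congr frac; congr (_, _, _); ring.
Qed.

Lemma frac_mul1 : left_id frac1 frac_mul.
Proof.
elim/frac_ind=> a b c; rewrite !frac_mulE; congr frac; congr (_, _, _); ring.
Qed.

Lemma frac_mulD : left_distributive frac_mul frac_add.
Proof.
elim/frac_ind=> a b c; elim/frac_ind=> a' b' c'; elim/frac_ind=> x y z.
rewrite frac_addE !frac_mulE frac_addE; apply/fracP => /=; ring.
Qed.

Lemma frac_1neq0 : frac1 != frac0.
Proof.
by apply/eqP => /fracP /=; rewrite !(mul0r, add0r, addr0, mulr1) => /eqP; rewrite oner_eq0.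
Qed.

HB.instance Definition _ :=
  GRing.Zmodule_isComNzRing.Build fraction frac_mulA frac_mulC frac_mul1 frac_mulD frac_1neq0.

Lemma frac_unit (x : fraction) : x != 0 -> exists y : fraction, y * x = 1.
Proof.
elim/frac_ind: x => a b c nz.
have [|E|] := dlt_total a b.
(* The fraction is [-(d + 1) / (c + 1)], with inverse [-(c + 1) / (d + 1)]. *)
- move=> /dlt_sub[d ->]; exists (frac (0, c + 1, d)).
  by rewrite [LHS]frac_mulE; apply/fracP => /=; ring.
- by case/eqP: nz; apply/fracP => /=; rewrite E; ring.
- move=> /dlt_sub[d ->]; exists (frac (c + 1, 0, d)).
  by rewrite [LHS]frac_mulE; apply/fracP => /=; ring.
Qed.

Definition frac_inv (x : fraction) : fraction :=
  if pselect (x != 0) is left nz then sval (cid (frac_unit nz)) else 0.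

Lemma frac_mulV (x : fraction) : x != 0 -> frac_inv x * x = 1.
Proof. by rewrite /frac_inv; case: pselect => // nz _; case: cid. Qed.

Lemma frac_inv0 : frac_inv 0 = 0.
Proof. by rewrite /frac_inv; case: pselect => // nz; case/eqP: (nz). Qed.

HB.instance Definition _ := GRing.ComNzRing_isField.Build fraction frac_mulV frac_inv0.

Definition frac_nonneg (x : fraction) := let: (a, b, c) := sval x in ~ dlt a b.

(** [frac_nonneg] looks at the chosen representative; [mono] shows that the sign is the same for all
    equivalent triples. *)
Lemma frac_nonnegE a b c : frac_nonneg (frac (a, b, c)) <-> exists d, a = b + d.
Proof.
rewrite -not_dltP /frac_nonneg.
have mono t u : frac_eq t u -> dlt t.1.1 t.1.2 -> dlt u.1.1 u.1.2.
  move: t u => [[x y] z] [[x' y'] z'] /= E xy.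
  apply: contrapT => /not_dltP[d E']; move: E; rewrite E'.
  have [e ->] := dlt_sub xy => E.
  apply: (@dlt_irr N (x * (z' + 1) + y' * (z + 1))); rewrite {2}E.
  have -> : (y' + d) * (z + 1) + (x + (e + 1)) * (z' + 1) =
    x * (z' + 1) + y' * (z + 1) + (d * (z + 1) + e * (z' + 1) + z' + 1) by ring.
  exact: dlt_addr.
move: (sval_frac (a, b, c)) => /[dup] /mono H /frac_eq_sym/mono H'.
move: H H'; case: (sval _) => [[x y] z] /= H H'; by split=> h ?; apply: h; auto.
Qed.

Definition frac_le (x y : fraction) : bool := `[< frac_nonneg (y - x) >].
Definition frac_lt (x y : fraction) : bool := (y != x) && frac_le x y.
Definition frac_norm (x : fraction) : fraction := if frac_le 0 x then x else - x.

Lemma frac_le0P x : reflect (frac_nonneg x) (frac_le 0 x).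
Proof. by rewrite /frac_le subr0; apply: asboolP. Qed.

Lemma frac_le0_add x y : frac_le 0 x -> frac_le 0 y -> frac_le 0 (x + y).
Proof.
elim/frac_ind: x => a b c; elim/frac_ind: y => a' b' c'.
move=> /frac_le0P/frac_nonnegE[d ->] /frac_le0P/frac_nonnegE[d' ->].
apply/frac_le0P; rewrite [_ + _]frac_addE; apply/frac_nonnegE.
by exists (d * (c' + 1) + d' * (c + 1)); ring.
Qed.

Lemma frac_le0_mul x y : frac_le 0 x -> frac_le 0 y -> frac_le 0 (x * y).
Proof.
elim/frac_ind: x => a b c; elim/frac_ind: y => a' b' c'.
move=> /frac_le0P/frac_nonnegE[d ->] /frac_le0P/frac_nonnegE[d' ->].
apply/frac_le0P; rewrite [_ * _]frac_mulE; apply/frac_nonnegE.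
by exists (d * d'); ring.
Qed.

Lemma frac_le0_oppP a b c : frac_le (frac (a, b, c)) 0 <-> exists d, b = a + d.
Proof.
rewrite /frac_le sub0r [- _]frac_oppE; split.
  by move=> /asboolP/frac_nonnegE.
by move=> /(frac_nonnegE b a c)/asboolP.
Qed.

Lemma frac_le0_anti x : frac_le 0 x -> frac_le x 0 -> x = 0.
Proof.
elim/frac_ind: x => a b c /frac_le0P/frac_nonnegE[d ->] /frac_le0_oppP /not_dltP bd.
apply/fracP => /=; suff -> : d = 0 by ring.
apply: contrapT => d0; apply: bd.
have [/(@not_dlt_addr 0 d)|//|] := dlt_total (0 + d) 0; rewrite ?add0r //.
by move=> /(@dlt_add _ _ _ b); rewrite add0r addrC.
Qed.

Lemma frac_le0_total x : frac_le 0 x || frac_le x 0.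
Proof.
elim/frac_ind: x => a b c.
have [/not_dltP/(frac_nonnegE a b c)/frac_le0P -> //|/contrapT ab] := EM (~ dlt a b).
apply/orP; right; apply/frac_le0_oppP.
by have [d ->] := dlt_sub ab; exists (d + 1).
Qed.

Lemma frac_sub_ge0 x y : frac_le 0 (y - x) = frac_le x y.
Proof. by rewrite /frac_le subr0. Qed.

Lemma frac_normN x : frac_norm (- x) = frac_norm x.
Proof.
rewrite /frac_norm -[frac_le 0 (- x)](_ : frac_le x 0 = _);
  last by rewrite /frac_le sub0r subr0.
case: ifP => x0; case: ifP => x0' //; rewrite ?opprK //.
  by rewrite (frac_le0_anti x0' x0) oppr0.
by move: (frac_le0_total x); rewrite x0 x0'.
Qed.

Lemma frac_ge0_norm x : frac_le 0 x -> frac_norm x = x.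
Proof. by rewrite /frac_norm => ->. Qed.

HB.instance Definition _ := Num.IntegralDomain_isLeReal.Build fraction
  frac_le0_add frac_le0_mul frac_le0_anti frac_sub_ge0 frac_le0_total frac_normN
  frac_ge0_norm (fun x y => erefl (frac_lt x y)).

Definition of_nat a : fraction := frac (a, 0, 0).

Lemma of_nat0 : of_nat 0 = 0.
Proof. by []. Qed.

Lemma of_nat1 : of_nat 1 = 1.
Proof. by []. Qed.

Lemma of_natD a b : of_nat (a + b) = of_nat a + of_nat b.
Proof. by rewrite [RHS]frac_addE; congr frac; congr (_, _, _); ring. Qed.

Lemma of_natM a b : of_nat (a * b) = of_nat a * of_nat b.
Proof. by rewrite [RHS]frac_mulE; congr frac; congr (_, _, _); ring. Qed.

Lemma of_nat_ge0 a : 0 <= of_nat a.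
Proof. by apply/frac_le0P/frac_nonnegE; exists a; rewrite add0r. Qed.

Lemma of_nat_inj : injective of_nat.
Proof. by move=> a b /fracP /=; rewrite !(mul0r, addr0, add0r, mulr1). Qed.

Lemma of_nat_lt a b : dlt a b <-> of_nat a < of_nat b.
Proof.
have lt x y : dlt x y -> of_nat x < of_nat y.
  move=> /dlt_sub[d ->]; rewrite !of_natD ltrDl; have := of_nat_ge0 d.
  by rewrite of_nat1; lra.
split=> [/lt //|ab]; have [//|E|/lt] := dlt_total a b; last by rewrite ltNge ltW.
by move: ab; rewrite E ltxx.
Qed.

Record field_embedding := FieldEmbedding {
  emb_field : realFieldType;
  emb : ds_sort N -> emb_field;
  emb0 : emb 0 = 0;
  emb1 : emb 1 = 1;
  embD : forall a b, emb (a + b) = emb a + emb b;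
  embM : forall a b, emb (a * b) = emb a * emb b;
  emb_ge0 : forall a, 0 <= emb a;
  emb_inj : injective emb;
  emb_lt : forall a b, dlt a b <-> emb a < emb b
}.

(** Opaque, so that nothing unfolds to the construction of the fractions. *)
Lemma fraction_embedding : field_embedding.
Proof. exact: (FieldEmbedding of_nat0 of_nat1 of_natD of_natM of_nat_ge0 of_nat_inj
  of_nat_lt). Qed.
End Fractions.

Lemma norm_ltE (R : realDomainType) (x y : R) : (`|x| < y) = (x < y /\ - x < y) :> Prop.
Proof.
rewrite ltr_norml; apply/propext; split=> [/andP[? ?]|[? ?]]; [split=> //|apply/andP;
  split=> //]; lra.
Qed.

Lemma norm_leE (R : realDomainType) (x y : R) : (`|x| <= y) = (x <= y /\ - x <= y) :> Prop.
Proof.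
rewrite ler_norml; apply/propext; split=> [/andP[? ?]|[? ?]]; [split=> //|apply/andP;
  split=> //]; lra.
Qed.

(** * Formulas and terms in a model *)

Arguments twk : simpl never.
Arguments And : simpl never.
Arguments Or : simpl never.
Arguments Neg : simpl never.
Arguments Iff : simpl never.
Arguments Ex : simpl never.

Record model := Model {
  model_structure :> structure;
  model_ax : model_axioms model_structure
}.

Section Evaluation.
Variable M : model.

Lemma sat_EqN V (rho : env M V) t u : sat rho (EqN t u) = (eval rho t = eval rho u).
Proof. by []. Qed.

Lemma sat_LtN V (rho : env M V) t u : sat rho (LtN t u) = ltM (eval rho t) (eval rho u).
Proof. by []. Qed.

Lemma sat_Imp V (rho : env M V) A B : sat rho (Imp A B) = (sat rho A -> sat rho B).
Proof. by []. Qed.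

Lemma sat_All V (rho : env M V) r A : sat rho (All r A) = forall m, sat (push m rho) A.
Proof. by []. Qed.

Lemma sat_Neg V (rho : env M V) A : sat rho (Neg A) = ~ sat rho A.
Proof. by []. Qed.

Lemma sat_And V (rho : env M V) A B : sat rho (And A B) = (sat rho A /\ sat rho B).
Proof. by apply/propext; split=> [/= /not_implyP[? /contrapT]|[? ?] /= H]; [|apply: H]. Qed.

Lemma sat_Iff V (rho : env M V) A B : sat rho (Iff A B) = (sat rho A <-> sat rho B).
Proof. by rewrite /Iff sat_And; apply/propext; split=> -[]. Qed.

Lemma sat_Ex V (rho : env M V) r A : sat rho (Ex r A) = exists m, sat (push m rho) A.
Proof.
apply/propext; split=> [/= /existsNP[m /contrapT mA]|[m mA] /= H]; first by exists m.
exact: H mA.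
Qed.

Lemma env_ext V (rho rho' : env M V) : (forall s v, rho s v = rho' s v) -> rho = rho'.
Proof. by move=> E; apply: functional_extensionality_dep => s; apply/funext => v. Qed.

Lemma eval_tsub V W (rho : env M W) (f : sub V W) s (t : tm V s) :
  eval rho (tsub f t) = eval (fun s v => eval rho (f s v)) t.
Proof. by elim: t => //= r r' t -> u ->. Qed.

Lemma eval_twk V (rho : env M V) r (m : dom M r) s (t : tm V s) :
  eval (push m rho) (twk r t) = eval rho t.
Proof. by rewrite twk_tsub eval_tsub. Qed.

Lemma push_sub V W (rho : env M W) (f : sub V W) r (m : dom M r) :
  (fun s v => eval (push m rho) (sub_up r f s v)) = push m (fun s v => eval rho (f s v)).
Proof. by apply: env_ext => s [|{}s v] //=; rewrite eval_twk. Qed.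

Lemma sat_fsub V W (rho : env M W) (f : sub V W) (A : fm V) :
  sat rho (fsub f A) = sat (fun s v => eval rho (f s v)) A.
Proof.
elim: A W rho f => {V} [V t u|V t u|V|V A IA B IB|V r A IA] W rho f //=.
- by rewrite !eval_tsub.
- by rewrite !eval_tsub.
- by rewrite IA IB.
- apply/propext; split=> H m; move: (H m); by rewrite IA push_sub.
Qed.

Lemma push_scons V (rho : env M V) r (t : tm V r) :
  (fun s (v : ext V r s) => eval rho (scons t (fun s v => Var v) v)) = push (eval rho t) rho.
Proof. by apply: env_ext => s []. Qed.

Lemma sat_EqT V (rho : env M V) s (t u : tm V s) :
  sat rho (EqT t u) <-> eval rho t = eval rho u.
Proof.
elim: s V rho t u => [|r _ s IH] V rho t u //; split=> [H|E] /=.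
  by apply: (ap_ext (model_ax M)) => z; have /IH := H z; rewrite /= !eval_twk.
by move=> z; apply/IH; rewrite /= !eval_twk E.
Qed.

(** A context whose variables are the elements of the model provides formulas
    with parameters. *)
Definition params : env M (dom M) := fun s v => v.

Lemma ap_Pi s t (x : dom M s) (y : dom M t) : ap (ap PiM x) y = x.
Proof.
by have /sat_EqT := sat_RCA0w (model_ax M) params (RCA_Pi (Var (V := dom M) x) (Var (V :=
  dom M) y)).
Qed.

Lemma ap_Sigma r s t (x : dom M (r ⟶ s ⟶ t)) (y : dom M (r ⟶ s)) (z : dom M r) :
  ap (ap (ap SigmaM x) y) z = ap (ap x z) (ap y z).
Proof.
by have /sat_EqT := sat_RCA0w (model_ax M) params
  (RCA_Sigma (Var (V := dom M) x) (Var (V := dom M) y) (Var (V := dom M) z)).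
Qed.

Lemma qf_induction (A : fm (ext (dom M) tN)) : quantifier_free A ->
  sat (push (zeroM M) params) A ->
  (forall n, sat (push n params) A -> sat (push (ap (ap (plusM M) n) (oneM M)) params) A) ->
  forall n, sat (push n params) A.
Proof.
move=> qA A0 AS; have := sat_RCA0w (model_ax M) params (RCA_ind qA).
change ((sat params (And (inst A Zero) (All tN (Imp A (at_succ A)))) ->
  forall n, sat (push n params) A) -> forall n, sat (push n params) A).
rewrite sat_And sat_All /inst sat_fsub push_scons; apply; split=> // n.
rewrite sat_Imp => /AS.
suff -> : sat (push n params) (at_succ A) = sat (push (ap (ap (plusM M) n) (oneM M))
  params) A by [].
by rewrite /at_succ sat_fsub; congr (sat _ A); apply: env_ext => s [].
Qed.

Lemma qf_choice (A : fm (ext (ext (dom M) t1) tN)) : quantifier_free A ->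
  (forall x, exists n, sat (push n (push x params)) A) ->
  exists Y : dom M t2, forall x, sat (push (ap Y x) (push x params)) A.
Proof.
move=> qA AE.
have H : (forall x, sat (push x params) (Ex tN A)) ->
  sat params (Ex (t1 ⟶ tN) (All t1 (at_choice A))) :=
  sat_RCA0w (model_ax M) params (RCA_QFAC qA).
have /H : forall x, sat (push x params) (Ex tN A) by move=> x; rewrite sat_Ex.
rewrite sat_Ex => -[Y]; rewrite sat_All => YA; exists Y => x; move: (YA x).
suff -> : sat (push x (push Y params)) (at_choice A) = sat (push (ap Y x) (push x params))
  A by [].
by rewrite /at_choice sat_fsub; congr (sat _ A); apply: env_ext => s [|{}s [|{}s v]].
Qed.

End Evaluation.

Arguments sat : simpl never.

(** Bracket abstraction; [Sigma Pi Pi] is the identity. *)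
Fixpoint lam V r s (t : tm (ext V r) s) : tm V (r ⟶ s) :=
  match t in tm _ s return tm V (r ⟶ s) with
  | Var _ v => match v in ext _ _ s return tm V (r ⟶ s) with
    | new => App (App Sigma Pi) (Pi (t := r))
    | old _ v => App Pi (Var v)
    end
  | App _ _ t u => App (App Sigma (lam t)) (lam u)
  | Zero => App Pi Zero
  | One => App Pi One
  | Plus => App Pi Plus
  | Times => App Pi Times
  | Pi _ _ => App Pi Pi
  | Sigma _ _ _ => App Pi Sigma
  | Rec => App Pi Rec
  end.

Lemma ap_lam (M : model) V (rho : env M V) r s (t : tm (ext V r) s) (m : dom M r) :
  ap (eval rho (lam t)) m = eval (push m rho) t.
Proof.
elim: t => [s' [|{}s' v]|s' t' f IHf u IHu|||||s' t'|r' s' t'|] /=;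
  rewrite ?ap_Sigma ?ap_Pi //.
by rewrite IHf IHu.
Qed.

(** * Arithmetic in a model *)

Section Arithmetic.
Variable M : model.

Definition num : Type := dom M tN.
Implicit Types a b c d m n : num.

Definition num_add a b : num := ap (ap (plusM M) a) b.
Definition num_mul a b : num := ap (ap (timesM M) a) b.

Local Notation V a := (Var (V := dom M) a).
Local Notation lt a b := (@ltM M (a : num) (b : num)).
Local Notation semiring_axiom A := (sat_RCA0w (model_ax M) (params (M := M)) (RCA_semiring A)).

Lemma num_addA : associative num_add.
Proof. move=> a b c; exact: (semiring_axiom (OS_addA (V a) (V b) (V c))). Qed.

Lemma num_addC : commutative num_add.
Proof. move=> a b; exact: (semiring_axiom (OS_addC (V a) (V b))). Qed.

Lemma num_add0 : left_id (zeroM M : num) num_add.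
Proof. move=> a; rewrite num_addC; exact: (semiring_axiom (OS_add0 (V a))). Qed.

Lemma num_mulA : associative num_mul.
Proof. move=> a b c; exact: (semiring_axiom (OS_mulA (V a) (V b) (V c))). Qed.

Lemma num_mulC : commutative num_mul.
Proof. move=> a b; exact: (semiring_axiom (OS_mulC (V a) (V b))). Qed.

Lemma num_mul1 : left_id (oneM M : num) num_mul.
Proof. move=> a; rewrite num_mulC; exact: (semiring_axiom (OS_mul1 (V a))). Qed.

Lemma num_mul0 : left_zero (zeroM M : num) num_mul.
Proof. move=> a; rewrite num_mulC; exact: (semiring_axiom (OS_mul0 (V a))). Qed.

Lemma num_mulD : left_distributive num_mul num_add.
Proof.
move=> a b c; rewrite num_mulC (num_mulC a) (num_mulC b).
exact: (semiring_axiom (OS_mulD (V c) (V a) (V b))).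
Qed.

Lemma num_lt_irr a : ~ lt a a.
Proof. exact: (semiring_axiom (OS_irrefl (V a))). Qed.

HB.instance Definition _ := gen_eqMixin num.
HB.instance Definition _ := gen_choiceMixin num.

Lemma num_1neq0 : (oneM M : num) != zeroM M.
Proof.
apply/eqP => E; apply: (@num_lt_irr (zeroM M)); rewrite -{2}E.
exact: (semiring_axiom (OS_lt01 (dom M))).
Qed.

HB.instance Definition _ := GRing.isNmodule.Build num num_addA num_addC num_add0.
HB.instance Definition _ := GRing.Nmodule_isComNzSemiRing.Build num
  num_mulA num_mulC num_mul1 num_mulD num_mul0 num_1neq0.

Lemma plusME a b : ap (ap (plusM M) a) b = a + b.
Proof. by []. Qed.

Lemma timesME a b : ap (ap (timesM M) a) b = a * b.
Proof. by []. Qed.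

Lemma zeroME : zeroM M = (0 : num).
Proof. by []. Qed.

Lemma oneME : oneM M = (1 : num).
Proof. by []. Qed.

Definition numE := (plusME, timesME, zeroME, oneME).

Lemma num_lt_trans a b c : lt a b -> lt b c -> lt a c.
Proof. exact: (semiring_axiom (OS_trans (V a) (V b) (V c))). Qed.

Lemma num_lt_total a b : [\/ lt a b, a = b | lt b a].
Proof.
have H : ~ lt a b -> ~ a = b -> lt b a := semiring_axiom (OS_total (V a) (V b)).
have [|nab] := EM (lt a b); first by constructor 1.
have [|neq] := EM (a = b); first by constructor 2.
by constructor 3; apply: H.
Qed.

Lemma num_lt_add a b c : lt a b -> lt (a + c) (b + c).
Proof. exact: (semiring_axiom (OS_lt_add (V a) (V b) (V c))). Qed.

Lemma num_lt_mul a b c : lt 0 c -> lt a b -> lt (a * c) (b * c).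
Proof. exact: (semiring_axiom (OS_lt_mul (V a) (V b) (V c))). Qed.

Lemma num_lt01 : lt (0 : num) 1.
Proof. exact: (semiring_axiom (OS_lt01 (dom M))). Qed.

Lemma ap_Rec0 f m : ap (ap (ap (RecM M) f) m) (0 : num) = m.
Proof. exact: (sat_RCA0w (model_ax M) (params (M := M)) (RCA_Rec0 (V f) (V m))). Qed.

Lemma ap_RecS f m n :
  ap (ap (ap (RecM M) f) m) (n + 1) = ap (ap f n) (ap (ap (ap (RecM M) f) m) n).
Proof. exact: (sat_RCA0w (model_ax M) (params (M := M)) (RCA_RecS (V f) (V m) (V n))). Qed.

Lemma num_lt_succ n : lt n (n + 1).
Proof. by have := num_lt_add n num_lt01; rewrite add0r addrC. Qed.

Lemma num_induction (A : fm (ext (dom M) tN)) : quantifier_free A ->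
  sat (push (0 : num) (params (M := M))) A ->
  (forall n, sat (push n (params (M := M))) A -> sat (push (n + 1) (params (M := M))) A) ->
  forall n, sat (push n (params (M := M))) A.
Proof. exact: qf_induction. Qed.

(** The semiring axioms alone allow negative elements, so induction is needed. *)
Lemma num_nlt0 n : ~ lt n 0.
Proof.
move: n; apply: (@num_induction (Neg (LtN (Var new) Zero))) => //; first exact: num_lt_irr.
by move=> n; rewrite !sat_Neg => n0 n1; apply: n0; apply: num_lt_trans n1; apply: num_lt_succ.
Qed.

Lemma num_0lt_succ n : lt 0 (n + 1).
Proof.
have [/num_nlt0//|<-|n0] := num_lt_total n 0; first exact: num_lt_succ.
exact: num_lt_trans n0 (num_lt_succ n).
Qed.

(** [Rec · Pi · 0] sends [n + 1] to [Pi · n · _ = n] and 0 to 0, so it is the predecessor. Its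
    iteration is truncated subtraction. *)
Definition pred_tm W : tm W t1 := App (App Rec Pi) Zero.
Definition monus_tm W (t u : tm W tN) : tm W tN :=
  App (App (App Rec (App Pi (pred_tm W))) t) u.

Definition pred n : num := ap (eval (params (M := M)) (pred_tm _)) n.
Definition monus a b : num := eval (params (M := M)) (monus_tm (V a) (V b)).

Lemma eval_monus W (rho : env M W) t u : eval rho (monus_tm t u) = monus (eval rho t) (eval
  rho u).
Proof. by []. Qed.

Lemma predS n : pred (n + 1) = n.
Proof. by rewrite /pred /= ap_RecS ap_Pi. Qed.

Lemma predK n : n <> 0 -> pred n + 1 = n.
Proof.
move: n; apply: (@num_induction (Imp (Neg (EqN (Var new) Zero))
  (EqN (App (App Plus (App (pred_tm _) (Var new))) One) (Var new)))) => //.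
  by move=> /(_ erefl).
by move=> n _ _; change (pred (n + 1) + 1 = n + 1); rewrite predS.
Qed.

Lemma monus0 a : monus a 0 = a.
Proof. exact: ap_Rec0. Qed.

Lemma monusS a d : monus a (d + 1) = pred (monus a d).
Proof. by rewrite {1}/monus /= ap_RecS ap_Pi. Qed.

Lemma monusK a d : ~ lt a d -> monus a d + d = a.
Proof.
move: d; apply: (@num_induction (Imp (Neg (LtN (Var (old (V := dom M) a)) (Var new)))
  (EqN (App (App Plus (monus_tm (Var (old a)) (Var new))) (Var new)) (Var (old a))))) => //.
  by move=> _; change (monus a 0 + 0 = a); rewrite monus0 addr0.
move=> d IH ad; change (monus a (d + 1) + (d + 1) = a); rewrite monusS.
have {}IH : monus a d + d = a.
  by apply: IH => ad'; apply: ad; apply: num_lt_trans ad' (num_lt_succ d).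
have nz : monus a d <> 0.
  by move=> E; apply: ad; rewrite -[a]IH E add0r; apply: num_lt_succ.
by rewrite [d + 1]addrC addrA (predK nz).
Qed.

(** Quantifier-free induction does not apply to this existential statement; the term [monus]
    provides the witness. *)
Lemma num_lt_sub a b : lt a b -> exists d, b = a + (d + 1).
Proof.
move=> ab; have E : monus b a + a = b.
  by apply: monusK => ba; apply: (num_lt_irr (num_lt_trans ab ba)).
have nz : monus b a <> 0.
  by move=> E0; apply: (@num_lt_irr a); move: ab; rewrite -{1}E E0 add0r.
by exists (pred (monus b a)); rewrite (predK nz) addrC.
Qed.

(** * The rationals of the model *)

Definition num_ds : discrete_semiring :=
  DiscreteSemiring num_lt_irr num_lt_trans num_lt_total num_lt_add num_lt_mul
    num_0lt_succ num_lt_sub.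

Definition rational : realFieldType := emb_field (fraction_embedding num_ds).
Definition toQ n : rational := emb (fraction_embedding num_ds) n.

Lemma toQ_0 : toQ 0 = 0.
Proof. exact: emb0. Qed.

Lemma toQ_1 : toQ 1 = 1.
Proof. exact: emb1. Qed.

Lemma toQ_D a b : toQ (a + b) = toQ a + toQ b.
Proof. exact: embD. Qed.

Lemma toQ_M a b : toQ (a * b) = toQ a * toQ b.
Proof. exact: embM. Qed.

Definition toQE := (toQ_0, toQ_1, toQ_D, toQ_M).

Lemma toQ_ge0 n : 0 <= toQ n.
Proof. exact: emb_ge0. Qed.

Lemma toQ_inj : injective toQ.
Proof. exact: emb_inj. Qed.

Lemma toQ_lt a b : lt a b <-> toQ a < toQ b.
Proof. exact: (emb_lt (fraction_embedding num_ds)). Qed.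

Lemma toQ_le a b : ~ lt a b <-> toQ b <= toQ a.
Proof. by rewrite toQ_lt leNgt; split=> [/negP|/negP]. Qed.

Lemma num_leP a b : toQ a <= toQ b <-> exists d, b = a + d.
Proof. by rewrite -toQ_le; apply: (@not_dltP num_ds). Qed.

Lemma toQ_lt_le1 a b : toQ a < toQ b -> toQ a + 1 <= toQ b.
Proof.
move=> /toQ_lt/num_lt_sub[d ->]; rewrite !toQE; have := toQ_ge0 d; lra.
Qed.

(** If no [s] qualified, induction on the quantifier-free formula [s * s <= q] would prove it for
    all [s], contrary to [s = q + 1]. *)
Lemma num_sqrt q : exists s, ~ lt q (s * s) /\ lt q ((s + 1) * (s + 1)).
Proof.
apply: contrapT => no; suff H s : ~ lt q (s * s).
  have /toQ_le := H (q + 1); rewrite !toQE; have := toQ_ge0 q; nra.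
move: s; apply: (@num_induction (Neg (LtN (Var (old (V :=
  dom M) q)) (App (App Times (Var new)) (Var new))))) => //.
  by rewrite sat_Neg sat_LtN /= numE mul0r; apply: num_nlt0.
move=> s qs q's; apply: no; exists s; split=> //.
Qed.

Lemma num_sqrt_uniq q s t : ~ lt q (s * s) -> lt q ((s + 1) * (s + 1)) ->
  ~ lt q (t * t) -> lt q ((t + 1) * (t + 1)) -> s = t.
Proof.
move=> /toQ_le s1 /toQ_lt s2 /toQ_le t1 /toQ_lt t2.
move: s1 s2 t1 t2; rewrite !toQE => s1 s2 t1 t2.
have s0 := toQ_ge0 s; have t0 := toQ_ge0 t.
have [/toQ_lt/toQ_lt_le1 L|//|/toQ_lt/toQ_lt_le1 L] := num_lt_total s t; exfalso; nra.
Qed.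

End Arithmetic.

(** * Codes of rationals *)

Arguments qwk : simpl never.

Lemma invr_double (F : realFieldType) (t : F) : 0 < t -> (t + t)^-1 = t^-1 / 2.
Proof. by move=> t0; field; lra. Qed.

Section Coding.
Variable M : model.
Local Notation num := (num M).
Local Notation rational := (rational M).
Local Notation par := (params (M := M)).
Implicit Types (a b c d m n : num) (x y : dom M t1).

Lemma sat_fwk V (rho : env M V) r (m : dom M r) A : sat (push m rho) (fwk r A) = sat rho A.
Proof. by rewrite fwk_fsub sat_fsub; congr (sat _ A); apply: env_ext. Qed.

Lemma quantifier_free_fwk V r (A : fm V) : quantifier_free A -> quantifier_free (fwk r A).
Proof. by rewrite fwk_fsub; apply: quantifier_free_fsub. Qed.

(** Choice for a quantifier-free formula that determines [n] is definition by cases; in particular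
    it gives characteristic functions. *)
Lemma qf_cases (A : fm (ext (dom M) t1)) (t u : tm (ext (dom M) t1) tN) : quantifier_free A ->
  exists F : dom M t2, forall x,
    (sat (push x par) A -> ap F x = eval (push x par) t) /\
    (~ sat (push x par) A -> ap F x = eval (push x par) u).
Proof.
move=> qA; pose B := And (Imp (fwk tN A) (EqN (Var new) (twk tN t)))
  (Imp (Neg (fwk tN A)) (EqN (Var new) (twk tN u))).
have BE x n : sat (push n (push x par)) B =
    ((sat (push x par) A -> n = eval (push x par) t) /\
     (~ sat (push x par) A -> n = eval (push x par) u)).
  by rewrite sat_And !sat_Imp !sat_fwk !sat_EqN !eval_twk.
have [||F HF] := @qf_choice M B.
- by have := quantifier_free_fwk tN qA.
- move=> x; have [Ax|nAx] := EM (sat (push x par) A).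
    by exists (eval (push x par) t); rewrite BE.
  by exists (eval (push x par) u); rewrite BE.
by exists F => x; rewrite -BE.
Qed.

Definition num_pair a b : num := (a + b) * (a + b) + a.

Lemma monus_addr a d : monus (d + a) d = a.
Proof.
apply: toQ_inj; have /(congr1 (@toQ M)) : monus (d + a) d + d = d + a.
  by apply: monusK; apply/toQ_le; rewrite toQE; have := toQ_ge0 a; lra.
by rewrite !toQE; lra.
Qed.

(** The integer square root of [(a + b)^2 + a] is [a + b]; subtracting its square leaves [a], and
    then [b] follows. Choice takes sequences as arguments, so a number enters as a constant
    sequence. *)
Lemma exists_unpair : exists F S : dom M t1, forall a b,
  ap F (num_pair a b) = a /\ ap S (num_pair a b) = b.
Proof.
have [||R HR] := @qf_choice M
  (And (Neg (LtN (App (Var (old new)) Zero) (App (App Times (Var new)) (Var new))))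
    (LtN (App (Var (old new)) Zero)
      (App (App Times (App (App Plus (Var new)) One)) (App (App Plus (Var new)) One)))).
- by [].
- move=> x; have [s Hs] := num_sqrt (ap x (0 : num)).
  by exists s; rewrite sat_And.
pose q : tm (ext (dom M) tN) tN := Var new.
pose r : tm (ext (dom M) tN) tN := App (Var (old R)) (App (Pi (t := tN)) q).
pose f := monus_tm q (App (App Times r) r).
exists (eval par (lam f)), (eval par (lam (monus_tm r f))) => a b.
have E : ap R (ap PiM (num_pair a b)) = a + b.
  have := HR (ap PiM (num_pair a b)); rewrite sat_And => -[].
  rewrite sat_Neg !sat_LtN /= ap_Pi !numE => r1 r2.
  apply: (num_sqrt_uniq r1 r2); first by apply/toQ_le; rewrite !toQE; have := toQ_ge0 a; lra.
  by apply/toQ_lt; rewrite !toQE; have := toQ_ge0 a; have := toQ_ge0 b; lra.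
rewrite !ap_lam !eval_monus /= !E !numE monus_addr; split=> //.
exact: monus_addr.
Qed.

Lemma exists_decoding : exists D : dom M t1 * dom M t1 * dom M t1, forall a b c,
  let q := num_pair (num_pair a b) c in
  [/\ ap D.1.1 q = a, ap D.1.2 q = b & ap D.2 q = c].
Proof.
have [F [S FS]] := exists_unpair.
pose comp (f g : dom M t1) :=
  eval par (lam (App (Var (old (V := dom M) f)) (App (Var (old g)) (Var new)))).
exists (comp F F, comp S F, S) => a b c q.
have [F1 S1] := FS (num_pair a b) c; have [F2 S2] := FS a b.
by rewrite /= !ap_lam /= F1.
Qed.

Definition pos_fun : dom M t1 := (sval (cid exists_decoding)).1.1.
Definition neg_fun : dom M t1 := (sval (cid exists_decoding)).1.2.
Definition den_fun : dom M t1 := (sval (cid exists_decoding)).2.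
Definition code_pos (q : num) : num := ap pos_fun q.
Definition code_neg (q : num) : num := ap neg_fun q.
Definition code_den (q : num) : num := ap den_fun q.

Definition rat_code a b c := num_pair (num_pair a b) c.
(** The pairing misses some numbers, such as 3, while the decoding functions are total. *)
Definition is_code (q : num) := q = rat_code (code_pos q) (code_neg q) (code_den q).
Definition val (q : num) : rational := (toQ (code_pos q) - toQ (code_neg q)) / (toQ
  (code_den q) + 1).

Lemma decode a b c : let q := rat_code a b c in
  [/\ code_pos q = a, code_neg q = b & code_den q = c].
Proof. exact: (svalP (cid exists_decoding)). Qed.

Lemma is_code_rat a b c : is_code (rat_code a b c).
Proof. by rewrite /is_code; have [-> -> ->] := decode a b c. Qed.

Lemma val_rat a b c : val (rat_code a b c) = (toQ a - toQ b) / (toQ c + 1).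
Proof. by rewrite /val; have [-> -> ->] := decode a b c. Qed.

Lemma rat_code0 : rat_code 0 0 0 = 0.
Proof. by rewrite /rat_code /num_pair !(addr0, mul0r). Qed.

Lemma is_code0 : is_code 0.
Proof. by rewrite -rat_code0; apply: is_code_rat. Qed.

Definition rat_env V (rho : env M V) (q : num) : env M (ext (ext (ext V tN) tN) tN) :=
  push (code_den q) (push (code_neg q) (push (code_pos q) rho)).

Definition rat_var V : qexp (ext (ext (ext V tN) tN) tN) :=
  QExp (Var (old (old new))) (Var (old new)) (App (App Plus (Var new)) One).
Arguments rat_var {V}.

(** Decoding is unique, so the three quantifiers have at most one witness, given by the decoding
    functions. *)
Lemma sat_with_rat V (rho : env M V) (q : tm V tN) A :
  sat rho (with_rat q A) = (is_code (eval rho q) /\ sat (rat_env rho (eval rho q)) (A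
    rat_var)).
Proof.
apply/propext; rewrite /with_rat /exists_ sat_Ex.
change (A _) with (A rat_var); split.
  move=> [a]; rewrite sat_Ex => -[b]; rewrite sat_Ex => -[c].
  rewrite sat_And sat_EqN !eval_twk /= => -[E].
  change (eval rho q = rat_code a b c) in E.
  have [Ea Eb Ec] := decode a b c.
  by rewrite E /rat_env Ea Eb Ec; split=> //; apply: is_code_rat.
move=> [cq Aq]; exists (code_pos (eval rho q)); rewrite sat_Ex; exists (code_neg (eval rho q)).
rewrite sat_Ex; exists (code_den (eval rho q)).
by rewrite sat_And sat_EqN !eval_twk.
Qed.

Definition qval V (rho : env M V) (p : qexp V) : rational :=
  (toQ (eval rho (qpos p)) - toQ (eval rho (qneg p))) / toQ (eval rho (qden p)).
Definition qwf V (rho : env M V) (p : qexp V) := 0 < toQ (eval rho (qden p)).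

Lemma eval_rat_env V (rho : env M V) (q : num) s (t : tm V s) :
  eval (rat_env rho q) (twk _ (twk _ (twk _ t))) = eval rho t.
Proof. by rewrite !eval_twk. Qed.

Lemma qval_wk V (rho : env M V) r (m : dom M r) (p : qexp V) :
  qval (push m rho) (qwk r p) = qval rho p.
Proof. by rewrite /qval /qwk /= !eval_twk. Qed.

Lemma qwf_wk V (rho : env M V) r (m : dom M r) (p : qexp V) :
  qwf (push m rho) (qwk r p) = qwf rho p.
Proof. by rewrite /qwf /qwk /= !eval_twk. Qed.

Lemma qval_rat_env V (rho : env M V) (q : num) (p : qexp V) :
  qval (rat_env rho q) (qwk _ (qwk _ (qwk _ p))) = qval rho p.
Proof. by rewrite !qval_wk. Qed.

Lemma qwf_rat_env V (rho : env M V) (q : num) (p : qexp V) :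
  qwf (rat_env rho q) (qwk _ (qwk _ (qwk _ p))) = qwf rho p.
Proof. by rewrite !qwf_wk. Qed.

Lemma qval_rat_var V (rho : env M V) (q : num) : qval (rat_env rho q) rat_var = val q.
Proof. by rewrite /qval /= !numE !toQE. Qed.

Lemma qwf_rat_var V (rho : env M V) (q : num) : qwf (rat_env rho q) rat_var.
Proof. by rewrite /qwf /= !numE !toQE; have := toQ_ge0 (code_den q); lra. Qed.

Lemma qwf_add V (rho : env M V) p q : qwf rho p -> qwf rho q -> qwf rho (qadd p q).
Proof. by rewrite /qwf /= numE toQE; apply: mulr_gt0. Qed.

Lemma qwf_sub V (rho : env M V) p q : qwf rho p -> qwf rho q -> qwf rho (qsub p q).
Proof. by move=> p0 q0; apply: qwf_add. Qed.

Lemma qval_add V (rho : env M V) p q : qwf rho p -> qwf rho q ->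
  qval rho (qadd p q) = qval rho p + qval rho q.
Proof.
rewrite /qwf /qval /= !numE !toQE => /lt0r_neq0 p0 /lt0r_neq0 q0.
rewrite addf_div //; congr (_ / _).
by rewrite !mulrBl opprD addrACA.
Qed.

Lemma qval_opp V (rho : env M V) p : qval rho (qopp p) = - qval rho p.
Proof. by rewrite /qval /= -mulNr opprB. Qed.

Lemma qval_sub V (rho : env M V) p q : qwf rho p -> qwf rho q ->
  qval rho (qsub p q) = qval rho p - qval rho q.
Proof. by move=> p0 q0; rewrite qval_add // qval_opp. Qed.

Lemma sat_qlt V (rho : env M V) p q : qwf rho p -> qwf rho q ->
  sat rho (qlt p q) = (qval rho p < qval rho q).
Proof.
rewrite /qwf /qval => p0 q0; apply/propext; rewrite /qlt sat_LtN /= !numE toQ_lt !toQE.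
rewrite ltr_pdivrMr // mulrAC ltr_pdivlMr //; split; lra.
Qed.

Lemma sat_qle V (rho : env M V) p q : qwf rho p -> qwf rho q ->
  sat rho (qle p q) = (qval rho p <= qval rho q).
Proof.
move=> p0 q0; rewrite /qle sat_Neg sat_qlt // leNgt.
by apply/propext; split=> [/negP|/negP].
Qed.

Lemma sat_qabs_lt V (rho : env M V) p q : qwf rho p -> qwf rho q ->
  sat rho (qabs_lt p q) = (`|qval rho p| < qval rho q).
Proof.
by move=> p0 q0; rewrite /qabs_lt sat_And !sat_qlt // qval_opp norm_ltE.
Qed.

Lemma sat_qabs_le V (rho : env M V) p q : qwf rho p -> qwf rho q ->
  sat rho (qabs_le p q) = (`|qval rho p| <= qval rho q).
Proof.
by move=> p0 q0; rewrite /qabs_le sat_And !sat_qle // qval_opp norm_leE.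
Qed.

Definition num_pow2 n : num := eval par (pow2 (Var (V := dom M) n)).

Lemma eval_pow2 V (rho : env M V) (t : tm V tN) : eval rho (pow2 t) = num_pow2 (eval rho t).
Proof. by []. Qed.

Lemma num_pow2_0 : num_pow2 0 = 1.
Proof. exact: ap_Rec0. Qed.

Lemma num_pow2S n : num_pow2 (n + 1) = num_pow2 n + num_pow2 n.
Proof. by rewrite {1}/num_pow2 /= ap_RecS ap_Pi !ap_Sigma !ap_Pi !numE. Qed.

Lemma num_pow2_gt0 n : 0 < toQ (num_pow2 n).
Proof.
rewrite -toQ_0; apply/toQ_lt; move: n.
apply: (@num_induction M (LtN Zero (pow2 (Var new)))) => //.
  by rewrite sat_LtN eval_pow2 num_pow2_0; apply: num_lt01.
move=> n; rewrite !sat_LtN !eval_pow2 /= num_pow2S !toQ_lt !toQE; lra.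
Qed.

Definition eps n : rational := (toQ (num_pow2 n))^-1.

Lemma eps_gt0 n : 0 < eps n.
Proof. by rewrite invr_gt0 num_pow2_gt0. Qed.

Lemma epsS n : eps (n + 1) = eps n / 2.
Proof.
by rewrite /eps num_pow2S toQE invr_double ?num_pow2_gt0.
Qed.

Lemma eps_anti n d : eps (n + d) <= eps n.
Proof.
rewrite lef_pV2 ?posrE ?num_pow2_gt0 //; apply/toQ_le; move: d.
apply: (@num_induction M (Neg (LtN (pow2 (App (App Plus (Var (old (V := dom M) n))) (Var new)))
  (pow2 (Var (old n)))))) => //.
  by rewrite sat_Neg sat_LtN !eval_pow2 /= !numE addr0; apply: num_lt_irr.
move=> d; rewrite !sat_Neg !sat_LtN !eval_pow2 /= !numE addrA num_pow2S !toQ_le !toQE.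
have := num_pow2_gt0 (n + d); lra.
Qed.

Lemma qwf_qpow V (rho : env M V) t : qwf rho (qpow t).
Proof. by rewrite /qwf eval_pow2 num_pow2_gt0. Qed.

Lemma qwf_qpow' V (rho : env M V) t : qwf rho (qpow' t).
Proof. by rewrite /qwf eval_pow2 num_pow2_gt0. Qed.

Lemma qval_qpow V (rho : env M V) t : qval rho (qpow t) = eps (eval rho t).
Proof. by rewrite /qval eval_pow2 /= !numE !toQE subr0 div1r. Qed.

Lemma qval_qpow' V (rho : env M V) t : qval rho (qpow' t) = 2 * eps (eval rho t).
Proof. by rewrite /qval eval_pow2 /= !numE !toQE subr0. Qed.

Lemma qwf_q0 V (rho : env M V) : qwf rho q0.
Proof. by rewrite /qwf /= numE toQE. Qed.

Lemma qval_q0 V (rho : env M V) : qval rho q0 = 0.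
Proof. by rewrite /qval /= !numE !toQE subr0 mul0r. Qed.
End Coding.
Arguments rat_var {V}.

(** * Meaning of the defined notions *)

Section Meaning.
Variable M : model.
Local Notation num := (num M).
Implicit Types (x y e : dom M t1) (D : dom M t2) (R : dom M (t1 ⟶ t1 ⟶ tN)).
Implicit Types (f u : dom M (t1 ⟶ t1)).

Definition real x := forall n i : num,
  is_code (ap x n) /\ is_code (ap x (n + i)) /\
  `|val (ap x n) - val (ap x (n + i))| < eps n.

Definition same_real x y := forall n : num,
  is_code (ap x n) /\ is_code (ap y n) /\ `|val (ap x n) - val (ap y n)| <= 2 * eps n.

Definition positive e := exists n : num, is_code (ap e n) /\ 2 * eps n < val (ap e n).

Definition closer x y e := exists n : num,
  is_code (ap x (n + 1)) /\ is_code (ap y (n + 1)) /\ is_code (ap e n) /\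
  `|val (ap x (n + 1)) - val (ap y (n + 1))| < val (ap e n) - 2 * eps n.

Ltac qwf_tac := by repeat first [apply: qwf_sub | apply: qwf_add | rewrite qwf_rat_env |
  apply: qwf_rat_var | apply: qwf_qpow | apply: qwf_qpow' | apply: qwf_q0].

Lemma sat_is_real V (rho : env M V) (x : tm V t1) : sat rho (is_real x) = real (eval rho x).
Proof.
rewrite /is_real /forall_ sat_All; apply: eq_forall => n.
rewrite sat_All; apply: eq_forall => i.
rewrite !sat_with_rat !eval_rat_env sat_qabs_lt; [|qwf_tac..].
rewrite qval_sub; [|qwf_tac..].
by rewrite !qval_rat_env !qval_rat_var qval_qpow !eval_rat_env /= !eval_twk /= !numE.
Qed.

Lemma sat_eq_real V (rho : env M V) (x : tm V t1) (y : tm V t1) :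
  sat rho (eq_real x y) = same_real (eval rho x) (eval rho y).
Proof.
rewrite /eq_real /forall_ sat_All; apply: eq_forall => n.
rewrite !sat_with_rat !eval_rat_env sat_qabs_le; [|qwf_tac..].
rewrite qval_sub; [|qwf_tac..].
by rewrite !qval_rat_env !qval_rat_var qval_qpow' !eval_rat_env /= !eval_twk /=.
Qed.

Lemma sat_real_pos V (rho : env M V) (e : tm V t1) : sat rho (real_pos e) = positive (eval
  rho e).
Proof.
rewrite /real_pos /exists_ sat_Ex; apply: eq_exists => n.
rewrite !sat_with_rat sat_qlt; [|qwf_tac..].
rewrite qval_add; [|qwf_tac..].
by rewrite qval_q0 add0r !qval_rat_var qval_qpow' !eval_rat_env /= !eval_twk.
Qed.

Lemma sat_dist_lt V (rho : env M V) (x : tm V t1) (y : tm V t1) (e : tm V t1) :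
  sat rho (dist_lt x y e) = closer (eval rho x) (eval rho y) (eval rho e).
Proof.
rewrite /dist_lt /exists_ sat_Ex; apply: eq_exists => n.
rewrite !sat_with_rat !eval_rat_env sat_qabs_lt; [|qwf_tac..].
rewrite !qval_sub; [|qwf_tac..].
by rewrite !qval_rat_env !qval_rat_var qval_qpow' !eval_rat_env /= !eval_twk /= !numE.
Qed.

Definition real_fun f :=
  (forall x, real x -> real (ap f x)) /\
  (forall x y, real x -> real y -> same_real x y -> same_real (ap f x) (ap f y)).

Lemma sat_is_real_fun V (rho : env M V) (f : tm V (t1 ⟶ t1)) : sat rho (is_real_fun f) =
  real_fun (eval rho f).
Proof.
rewrite /is_real_fun /forall_ sat_And !sat_All; congr and; apply: eq_forall => x.
  by rewrite sat_Imp !sat_is_real /= !eval_twk.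
rewrite sat_All; apply: eq_forall => y.
by rewrite !sat_Imp !sat_is_real !sat_eq_real /= !eval_twk.
Qed.

Definition directed_by D R :=
  (exists x, ap D x = (1 : num)) /\
  (forall x, ap D x = (1 : num) -> ap (ap R x) x = (1 : num)) /\
  (forall x y z, ap D x = (1 : num) -> ap D y = (1 : num) -> ap D z = (1 : num) ->
     ap (ap R x) y = (1 : num) -> ap (ap R y) z = (1 : num) -> ap (ap R x) z = (1 : num)) /\
  (forall x y, ap D x = (1 : num) -> ap D y = (1 : num) ->
      exists z, ap D z = (1 : num) /\ ap (ap R x) z = (1 : num) /\ ap (ap R y) z = (1 : num)).

Lemma sat_directed V (rho : env M V) (D : tm V t2) (R : tm V (t1 ⟶ t1 ⟶ tN)) :
  sat rho (directed D R) = directed_by (eval rho D) (eval rho R).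
Proof.
rewrite /directed /forall_ /exists_ /in_set /related !sat_And; congr and.
  by rewrite sat_Ex; apply: eq_exists => x; rewrite sat_EqN /= !eval_twk.
congr and.
  by rewrite sat_All; apply: eq_forall => x; rewrite sat_Imp !sat_EqN /= !eval_twk.
congr and.
  rewrite sat_All; apply: eq_forall => x; rewrite sat_All; apply: eq_forall => y.
  rewrite sat_All; apply: eq_forall => z.
  by rewrite !sat_Imp !sat_EqN /= !eval_twk /=.
rewrite sat_All; apply: eq_forall => x; rewrite sat_All; apply: eq_forall => y.
rewrite 2!sat_Imp !sat_EqN /= !eval_twk /=; congr (_ -> _ -> _).
rewrite sat_Ex; apply: eq_exists => z.
by rewrite !sat_And !sat_EqN /= !eval_twk /=.
Qed.

Definition net D R u :=
  (forall x, ~ ltM (1 : num) (ap D x)) /\ (forall x y, ~ ltM (1 : num) (ap (ap R x) y)) /\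
  directed_by D R /\ (forall d, ap D d = (1 : num) -> real (ap u d)).

Lemma sat_is_net V (rho : env M V) (D : tm V t2) (R : tm V (t1 ⟶ t1 ⟶ tN)) (u : tm V (t1 ⟶
  t1)) :
  sat rho (is_net D R u) = net (eval rho D) (eval rho R) (eval rho u).
Proof.
rewrite /is_net /char_set /char_rel /forall_ 3!sat_And sat_directed; congr and.
  by rewrite sat_All; apply: eq_forall => x; rewrite /leN sat_Neg sat_LtN /= !eval_twk.
congr and.
  rewrite sat_All; apply: eq_forall => x; rewrite sat_All; apply: eq_forall => y.
  by rewrite /leN sat_Neg sat_LtN /= !eval_twk.
congr and; rewrite sat_All; apply: eq_forall => d.
by rewrite sat_Imp sat_is_real sat_EqN /= !eval_twk.
Qed.

Definition converges D R u y := forall e, real e /\ positive e ->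
  exists d0, ap D d0 = (1 : num) /\
    forall d, ap D d = (1 : num) /\ ap (ap R d0) d = (1 : num) -> closer (ap u d) y e.

Lemma sat_net_cvg V (rho : env M V) (D : tm V t2) (R : tm V (t1 ⟶ t1 ⟶ tN)) (u : tm V (t1 ⟶
  t1)) (y : tm V t1) :
  sat rho (net_cvg D R u y) = converges (eval rho D) (eval rho R) (eval rho u) (eval rho y).
Proof.
rewrite /net_cvg /forall_ /exists_ sat_All; apply: eq_forall => e.
rewrite sat_Imp sat_And sat_is_real sat_real_pos; congr (_ -> _).
rewrite sat_Ex; apply: eq_exists => d0.
rewrite sat_And /in_set sat_EqN /= !eval_twk; congr and.
rewrite sat_All; apply: eq_forall => d.
by rewrite sat_Imp sat_And /related !sat_EqN sat_dist_lt /= !eval_twk /=.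
Qed.

Definition comp f u : dom M (t1 ⟶ t1) := ap (ap SigmaM (ap PiM f)) u.

Lemma ap_comp f u x : ap (comp f u) x = ap f (ap u x).
Proof. by rewrite /comp ap_Sigma ap_Pi. Qed.

Definition net_continuous_at f x := forall D R u,
  net D R u -> converges D R u x -> converges D R (comp f u) (ap f x).

Lemma sat_net_continuous V (rho : env M V) (f : tm V (t1 ⟶ t1)) (x : tm V t1) :
  sat rho (net_continuous f x) = net_continuous_at (eval rho f) (eval rho x).
Proof.
rewrite /net_continuous /forall_ sat_All; apply: eq_forall => D.
rewrite sat_All; apply: eq_forall => R; rewrite sat_All; apply: eq_forall => u.
by rewrite 2!sat_Imp sat_is_net !sat_net_cvg /= !eval_twk.
Qed.

Definition continuous_at f x := forall e, real e /\ positive e ->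
  exists d, real d /\ positive d /\
    forall y, real y -> closer x y d -> closer (ap f x) (ap f y) e.

Lemma sat_eps_delta_continuous V (rho : env M V) (f : tm V (t1 ⟶ t1)) (x : tm V t1) :
  sat rho (eps_delta_continuous f x) = continuous_at (eval rho f) (eval rho x).
Proof.
rewrite /eps_delta_continuous /forall_ /exists_ sat_All; apply: eq_forall => e.
rewrite sat_Imp sat_And sat_is_real sat_real_pos; congr (_ -> _).
rewrite sat_Ex; apply: eq_exists => d.
rewrite 2!sat_And sat_is_real sat_real_pos; congr (_ /\ (_ /\ _)).
rewrite sat_All; apply: eq_forall => y.
by rewrite 2!sat_Imp sat_is_real !sat_dist_lt /= !eval_twk /=.
Qed.
End Meaning.

(** * Turning sequences into reals *)

Section Regularization.
Variable M : model.
Local Notation num := (num M).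
Local Notation par := (params (M := M)).
Implicit Types (x y e : dom M t1).

(** Several arguments are packed into one sequence, because [QF-AC^{1,0}] yields functionals of a
    single argument of type 1. *)
Definition cons_tm W (k : tm W tN) (d : tm W t1) : tm W t1 :=
  (Rec · (Sigma · (Pi · Pi) · d) · k)%tm.

Definition cons (k : num) (d : dom M t1) : dom M t1 :=
  eval par (cons_tm (Var (V := dom M) k) (Var (V := dom M) d)).

Lemma cons0 k d : ap (cons k d) (0 : num) = k.
Proof. exact: ap_Rec0. Qed.

Lemma consS k d (n : num) : ap (cons k d) (n + 1) = ap d n.
Proof. by rewrite /cons /= ap_RecS ap_Sigma !ap_Pi. Qed.

Lemma cons1 k d : ap (cons k d) (1 : num) = ap d (0 : num).
Proof. by have := consS k d 0; rewrite add0r. Qed.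

Local Notation "# a" := (Var (old (V := dom M) a)) (at level 1, a at level 0).

(** [with_rat] contains quantifiers, so it cannot occur in choice or induction. With the decoding
    functions as parameters, [code_fm] and [rat_of] are its quantifier-free substitute. *)
Definition code_fm r (t : tm (ext (dom M) r) tN) : fm (ext (dom M) r) :=
  EqN t (npair (npair (#(pos_fun M) · t) (#(neg_fun M) · t)) (#(den_fun M) · t))%tm.

Definition rat_of r (t : tm (ext (dom M) r) tN) : qexp (ext (dom M) r) :=
  QExp (#(pos_fun M) · t) (#(neg_fun M) · t) (#(den_fun M) · t + 1).

Lemma sat_code_fm r (m : dom M r) t :
  sat (push m par) (code_fm t) = is_code (eval (push m par) t).
Proof. by []. Qed.

Lemma qval_rat_of r (m : dom M r) t :
  qval (push m par) (rat_of t) = val (eval (push m par) t).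
Proof. by rewrite /qval /= !numE !toQE. Qed.

Lemma qwf_rat_of r (m : dom M r) t : qwf (push m par) (rat_of t).
Proof.
by rewrite /qwf /= !numE !toQE; have := toQ_ge0 (code_den (eval (push m par) t)); lra.
Qed.

Lemma sat_rat_near r (m : dom M r) t u (v : qexp (ext (dom M) r)) : qwf (push m par) v ->
  sat (push m par) (qabs_lt (qsub (rat_of t) (rat_of u)) v) =
  (`|val (eval (push m par) t) - val (eval (push m par) u)| < qval (push m par) v).
Proof.
move=> v0; rewrite sat_qabs_lt // ?qval_sub ?qval_rat_of //;
  by repeat (apply: qwf_sub || apply: qwf_rat_of).
Qed.

Lemma exists_regularization_step : exists I F : dom M t2,
  (forall y, (is_code (ap y (1 : num)) -> ap I y = ap y (1 : num)) /\
             (~ is_code (ap y (1 : num)) -> ap I y = (0 : num))) /\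
  (forall y (m p : num), let z := ap y (m + 1 + 1) in
    let: near := is_code z /\ `|val p - val z| < eps (m + 1) in
    (near -> ap F (cons m (cons p y)) = z) /\ (~ near -> ap F (cons m (cons p y)) = p)).
Proof.
pose x : tm (ext (dom M) t1) t1 := Var new.
have [|I HI] := @qf_cases M (code_fm (x · 1)%tm) (x · 1)%tm 0%tm; first by [].
(* In [cons m (cons p y)] the terms of [y] start at place 2, so [y_(m+2)] is at place [m + 4]. *)
pose m := (x · 0)%tm; pose p := (x · 1)%tm; pose z := (x · (m + 1 + 1 + 1 + 1))%tm.
have [|F HF] := @qf_cases M (And (code_fm z) (qabs_lt (qsub (rat_of p) (rat_of z)) (qpow (m
  + 1)%tm))) z p.
  by [].
exists I, F; split=> [y|y k q]; first exact: HI.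
have := HF (cons k (cons q y)); rewrite sat_And sat_code_fm sat_rat_near; last exact: qwf_qpow.
by rewrite qval_qpow /= !numE cons0 cons1 cons0 !consS.
Qed.

(** Shift the sequence by one and skip each term that is not the code of a
    rational close enough to the last one kept. The shift makes the local test
    [|h_n - y_(n+2)| < 2^(-(n+1))], which reals pass, sufficient for the modulus
    of a real. *)
Lemma exists_regularization : exists h : dom M (t1 ⟶ t1),
  (forall y, real (ap h y)) /\
  (forall y, real y -> forall n : num, ap (ap h y) n = ap y (n + 1)).
Proof.
have [I [F [HI HF]]] := exists_regularization_step.
pose body : tm (ext (dom M) t1) (tN ⟶ tN ⟶ tN) :=
  lam (lam (Var (old (old (old F))) · cons_tm (Var (old new)) (cons_tm (Var new) (Var (old
    (old new))))))%tm.
pose h := eval par (lam (Rec · body · (#I · Var new))%tm).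
have h0 y : ap (ap h y) (0 : num) = ap I y by rewrite ap_lam; apply: ap_Rec0.
have hS y (m : num) : ap (ap h y) (m + 1) = ap F (cons m (cons (ap (ap h y) m) y)).
  rewrite /h ap_lam.
  change (ap (ap (ap (RecM M) (eval (push y par) body)) (ap I y)) (m + 1) =
    ap F (cons m (cons (ap (ap (ap (RecM M) (eval (push y par) body)) (ap I y)) m) y))).
  by rewrite ap_RecS /body !ap_lam.
exists h; split=> [y|y ry]; last first.
  have Hc : forall n : num, is_code (ap y n) by move=> n; have [] := ry n 0.
  move=> n; move: n; apply: (@num_induction M (EqN (#(ap h y) · Var new) (#y · (Var new +
    1)))%tm) => //.
    by rewrite sat_EqN /= !numE h0 add0r; apply: (HI y).1.
  move=> n; rewrite !sat_EqN /= !numE => IH; rewrite hS IH.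
  by apply: (HF y n _).1; split=> //; have [_ [_]] := ry (n + 1) 1.
have hc n : is_code (ap (ap h y) n).
  move: n; apply: (@num_induction M (code_fm (#(ap h y) · Var new)%tm)) => //.
    rewrite sat_code_fm /= h0; have [y1|y1] := EM (is_code (ap y (1 : num))).
      by rewrite (HI y).1.
    by rewrite (HI y).2 //; apply: is_code0.
  move=> n; rewrite !sat_code_fm /= => IH; rewrite hS.
  set near := is_code (ap y (n + 1 + 1)) /\
    `|val (ap (ap h y) n) - val (ap y (n + 1 + 1))| < eps (n + 1).
  have [nr|far] := EM near; first by rewrite (HF y n _).1 //; case: nr.
  by rewrite (HF y n _).2.
have hstep (n : num) : `|val (ap (ap h y) n) - val (ap (ap h y) (n + 1))| < eps (n + 1).
  rewrite hS; set near := is_code (ap y (n + 1 + 1)) /\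
    `|val (ap (ap h y) n) - val (ap y (n + 1 + 1))| < eps (n + 1).
  have [nr|far] := EM near; first by rewrite (HF y n _).1 //; case: nr.
  by rewrite (HF y n _).2 // subrr normr0 eps_gt0.
(* The bound telescopes, since [eps (m + 1) = eps m - eps (m + 1)]; the subtracted term makes the
   induction go through. [E] turns the claim into a quantifier-free formula. *)
have hsum (n i : num) : `|val (ap (ap h y) n) - val (ap (ap h y) (n + i))| <= eps n - eps
  (n + i).
  have E (i' : num) : sat (push i' par) (qabs_le (qsub (rat_of (#(ap h y) · #n)%tm)
      (rat_of (#(ap h y) · (#n + Var new))%tm)) (qsub (qpow #n) (qpow (#n + Var new)%tm))) =
      (`|val (ap (ap h y) n) - val (ap (ap h y) (n + i'))| <= eps n - eps (n + i')).
    rewrite sat_qabs_le ?qval_sub ?qval_rat_of ?qval_qpow //;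
      by repeat first [apply: qwf_sub | apply: qwf_rat_of | apply: qwf_qpow].
  rewrite -E; move: i; apply: num_induction => //.
    by rewrite E addr0 !subrr normr0.
  move=> i; rewrite !E addrA.
  have := hstep (n + i); rewrite norm_ltE !norm_leE epsS.
  move=> [? ?] [? ?]; split; lra.
move=> n i; split=> //; split=> //; apply: le_lt_trans (hsum n i) _.
by have := eps_gt0 (n + i); lra.
Qed.
End Regularization.

(** * Net continuity *)

Section NetContinuity.
Variable M : model.
Local Notation num := (num M).
Local Notation par := (params (M := M)).
Implicit Types (x y z e w : dom M t1) (m n k : num) (f : dom M (t1 ⟶ t1)).

Local Notation "# a" := (Var (old (V := dom M) a)) (at level 1, a at level 0).
Local Notation "x @[ n ]" := (val (ap x n)) (at level 2, left associativity, format "x @[ n ]").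

Lemma real_is_code x n : real x -> is_code (ap x n).
Proof. by move=> rx; have [] := rx n 0. Qed.

Lemma real_near x m n : real x -> toQ m <= toQ n -> `|x@[m] - x@[n]| < eps m.
Proof. by move=> rx /num_leP[i ->]; have [_ []] := rx m i. Qed.

Lemma eps_le m n : toQ m <= toQ n -> eps n <= eps m.
Proof. by move=> /num_leP[i ->]; apply: eps_anti. Qed.

Lemma closer_sym x y e : closer x y e -> closer y x e.
Proof. by move=> [n [? [? [? ?]]]]; exists n; rewrite distrC. Qed.

Lemma exists_dyadic n : exists d : dom M t1,
  [/\ real d, positive d & forall k, d@[k] = eps n].
Proof.
have [c Ec] : exists c, num_pow2 n = c + 1.
  have /num_lt_sub[c] : ltM (0 : num) (num_pow2 n).
    by apply/toQ_lt; rewrite toQ_0 num_pow2_gt0.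
  by rewrite add0r => Ec; exists c.
pose q : num := rat_code 1 0 c.
have qc : is_code q by apply: is_code_rat.
have qv : val q = eps n by rewrite val_rat /eps Ec !toQE subr0 div1r.
exists (ap PiM q); split.
- by move=> m i; rewrite !ap_Pi subrr normr0; split=> //; split=> //; apply: eps_gt0.
- exists (n + 1 + 1); rewrite ap_Pi qv; split=> //.
  by rewrite !epsS; have := eps_gt0 n; lra.
- by move=> k; rewrite ap_Pi.
Qed.

(** The first term of an index is dropped and the rest is regularized; the regularization causes the
    shift by one. *)
Lemma exists_net_map : exists u : dom M (t1 ⟶ t1), (forall w, real (ap u w)) /\
  forall n y, real y -> forall k, ap (ap u (cons n y)) k = ap y (k + 1).
Proof.
have [h [hr hy]] := exists_regularization M.
pose u := eval par (lam (#h · lam (Var (old new) · (Var new + 1)))%tm).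
exists u; split=> [w|n y ry k]; first by rewrite ap_lam; apply: hr.
rewrite ap_lam.
(* Dropping the first term of [cons n y] gives [y] itself, by extensionality of the model. *)
have E : eval (push (cons n y) par) (lam (Var (old new) · (Var new + 1))%tm) = y.
  apply: (ap_ext (model_ax M)) => i; rewrite ap_lam; exact: consS.
change (ap (ap h (eval (push (cons n y) par) (lam (Var (old new) · (Var new + 1))%tm))) k =
  ap y (k + 1)).
by rewrite E hy.
Qed.

(** The comparison concerns only first terms, and [cons (w 0) w'] has both of them at its places 0
    and 1. *)
Lemma exists_index_order : exists R : dom M (t1 ⟶ t1 ⟶ tN), forall w w',
  (~ ltM (ap w' (0 : num)) (ap w (0 : num)) -> ap (ap R w) w' = (1 : num)) /\
  (ltM (ap w' (0 : num)) (ap w (0 : num)) -> ap (ap R w) w' = (0 : num)).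
Proof.
have [|G HG] := @qf_cases M (Neg (LtN (Var new · 1) (Var new · 0)))%tm 1%tm 0%tm; first by [].
exists (eval par (lam (lam (Var (old (old G)) · cons_tm (Var (old new) · 0) (Var new))))%tm).
move=> w w'; rewrite !ap_lam.
change (eval (push w' (push w par)) _) with (ap G (cons (ap w (0 : num)) w')).
have := HG (cons (ap w (0 : num)) w'); rewrite sat_Neg sat_LtN /= !numE cons0 cons1.
by move=> [H1 H0]; split=> // L; apply: H0.
Qed.

(** Each inequality is at a fixed place, which makes the condition quantifier-free. The threshold
    [n0] will keep [e_n - 3 * eps n] uniformly away from 0. *)
Definition discontinuity_at (f : dom M (t1 ⟶ t1)) (u : dom M (t1 ⟶ t1)) x e n0 w :=
  let n : num := ap w (0 : num) in let y := ap u w in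
  [/\ toQ n0 <= toQ n, `|x@[n] - y@[n]| < 4 * eps n &
    e@[n] - 3 * eps n <= `|(ap f x)@[n + 1] - (ap f y)@[n + 1]|].

Lemma exists_index_set f u x e n0 : exists D : dom M t2, forall w,
  (discontinuity_at f u x e n0 w -> ap D w = (1 : num)) /\
  (~ discontinuity_at f u x e n0 w -> ap D w = (0 : num)).
Proof.
pose n : tm (ext (dom M) t1) tN := (Var new · 0)%tm.
pose y : tm (ext (dom M) t1) t1 := (#u · Var new)%tm.
pose A := And (Neg (LtN n #n0))
  (And (qabs_lt (qsub (rat_of (#x · n)%tm) (rat_of (y · n)%tm)) (qadd (qpow' n) (qpow' n)))
  (Neg (qabs_lt (qsub (rat_of (#(ap f x) · (n + 1))%tm) (rat_of (#f · y · (n + 1))%tm))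
    (qsub (rat_of (#e · n)%tm) (qadd (qpow n) (qpow' n)))))).
have [|D HD] := @qf_cases M A 1%tm 0%tm; first by [].
exists D => w; have := HD w; suff -> : sat (push w par) A = discontinuity_at f u x e n0 w
  by [].
rewrite /A 2!sat_And (sat_Neg _ (LtN _ _)) (sat_Neg _ (qabs_lt _ _)) !sat_rat_near;
  try by repeat first [apply: qwf_sub | apply: qwf_add | apply: qwf_rat_of | apply:
    qwf_qpow | apply: qwf_qpow'].
rewrite qval_sub ?qval_add ?qval_rat_of ?qval_qpow ?qval_qpow';
  try by repeat first [apply: qwf_sub | apply: qwf_add | apply: qwf_rat_of | apply:
    qwf_qpow | apply: qwf_qpow'].
rewrite sat_LtN (propext (toQ_le _ _)) /discontinuity_at /= !numE.
have two (t : rational M) : 2 * t + 2 * t = 4 * t by lra.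
have three (t : rational M) : t + 2 * t = 3 * t by lra.
rewrite two three.
apply/propext; split=> [[? [? far]]|[? ? far]]; (split=> //; try split=> //).
  by rewrite leNgt; exact/negP.
by move: far; rewrite leNgt => /negP.
Qed.

Lemma discontinuity_cofinal f u x e n0 n :
  real_fun f -> real x -> real e ->
  (forall w, real (ap u w)) ->
  (forall n y, real y -> forall k, ap (ap u (cons n y)) k = ap y (k + 1)) ->
  (forall d, real d -> positive d ->
     exists y, [/\ real y, closer x y d & ~ closer (ap f x) (ap f y) e]) ->
  toQ n0 <= toQ n ->
  exists w, ap w (0 : num) = n /\ discontinuity_at f u x e n0 w.
Proof.
move=> [rf ef] rx re ru uE disc n0n.
have [d [rd pd dE]] := exists_dyadic n.
have [y [ry [k [_ [_ [_ kd]]]] nfy]] := disc d rd pd.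
exists (cons n y); rewrite cons0; split=> //; rewrite /discontinuity_at cons0.
pose z := ap u (cons n y); have zE := uE n y ry; split=> //.
- rewrite zE; rewrite dE in kd.
  have ek := eps_gt0 k; have en := eps_gt0 n.
  (* The real [d] is constantly [eps n], so the witness [k] satisfies [2 * eps k < eps n]. *)
  have nk : toQ n <= toQ k.
    rewrite leNgt; apply/negP => /ltW/eps_le.
    move: (normr_ge0 (x@[k + 1] - y@[k + 1])); lra.
  have nk1 : toQ (n + 1) <= toQ (k + 1) by rewrite !toQE; lra.
  have nk2 : toQ n <= toQ (k + 1) by rewrite !toQE; lra.
  have := real_near rx nk2; have := real_near ry nk1; move: kd.
  rewrite !norm_ltE epsS => -[? ?] [? ?] [? ?]; split; lra.
(* The real [z] is [y] shifted by one, so [f] maps both to equal reals. *)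
- have yz : same_real z y.
    move=> m; rewrite zE; split; [exact: real_is_code|split; first exact: real_is_code].
    have m1 : toQ m <= toQ (m + 1) by rewrite !toQE; lra.
    rewrite distrC; have := real_near ry m1; have := eps_gt0 m; lra.
  have [_ [_]] := ef z y (ru _) ry yz (n + 1); rewrite norm_leE epsS => -[z1 z2].
  rewrite leNgt; apply/negP; rewrite norm_ltE => -[f1 f2]; apply: nfy.
  exists n; do 2 (split; first exact/real_is_code/rf).
  split; first exact: real_is_code.
  rewrite norm_ltE; split; lra.
Qed.

Lemma index_set_net f u x e n0 D R :
  (forall w, real (ap u w)) ->
  (forall w, (discontinuity_at f u x e n0 w -> ap D w = (1 : num)) /\
    (~ discontinuity_at f u x e n0 w -> ap D w = (0 : num))) ->
  (forall w w', (~ ltM (ap w' (0 : num)) (ap w (0 : num)) -> ap (ap R w) w' = (1 : num)) /\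
    (ltM (ap w' (0 : num)) (ap w (0 : num)) -> ap (ap R w) w' = (0 : num))) ->
  (exists w, discontinuity_at f u x e n0 w) ->
  net D R u.
Proof.
move=> ru HD HR [w0 w0D].
have nlt10 : ~ ltM (1 : num) (0 : num) by apply: num_nlt0.
have RP w w' : ap (ap R w) w' = (1 : num) <-> toQ (ap w (0 : num)) <= toQ (ap w' (0 : num)).
  rewrite -toQ_le; split=> [E L|]; last exact: (HR w w').1.
  by move: E; rewrite (HR w w').2 // => E; case/eqP: (num_1neq0 M).
split=> [w|].
  have [/(HD w).1 ->|/(HD w).2 ->] := EM (discontinuity_at f u x e n0 w);
    first exact: num_lt_irr.
  exact: nlt10.
split=> [w w'|].
  have [/(HR w w').2 ->|/(HR w w').1 ->] := EM (ltM (ap w' (0 : num)) (ap w (0 : num))).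
    exact: nlt10.
  exact: num_lt_irr.
split; last by move=> d _; apply: ru.
split; first by exists w0; apply: (HD w0).1.
split; first by move=> w _; apply/RP.
split; first by move=> w w' w'' _ _ _ /RP ww' /RP w'w''; apply/RP/(le_trans ww').
move=> w w' wD w'D.
have [ww'|w'w] := leP (toQ (ap w (0 : num))) (toQ (ap w' (0 : num))).
  by exists w'; split=> //; split; apply/RP.
by exists w; split=> //; split; apply/RP => //; apply: ltW.
Qed.

Lemma positive_tail e n0 n : real e -> 2 * eps n0 < e@[n0] -> toQ n0 <= toQ n ->
  eps n0 < e@[n].
Proof. by move=> re en0 /(real_near re); rewrite norm_ltE => -[? ?]; lra. Qed.

Lemma discontinuity_not_net_continuous f x e :
  real_fun f -> real x -> real e -> positive e ->
  (forall d, real d -> positive d ->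
     exists y, [/\ real y, closer x y d & ~ closer (ap f x) (ap f y) e]) ->
  ~ net_continuous_at f x.
Proof.
move=> rf rx re [N [_ eN]] disc fx.
(* For [n >= n0] one has [e_n > eps N = 8 * eps n0], so the indices give values that differ from
   [f x] by more than [5 * eps n0] at place [n + 1]. Convergence within [eps n0] will bound this
   difference by [2 * eps n0]. *)
pose n0 : num := N + 1 + 1 + 1.
have [u [ru uE]] := exists_net_map.
have [D HD] := exists_index_set f u x e n0.
have [R HR] := exists_index_order.
have cofinal n : toQ n0 <= toQ n -> exists w, ap w (0 : num) = n /\ discontinuity_at f u x
  e n0 w.
  exact: discontinuity_cofinal.
have netD : net D R u.
  by apply: (index_set_net ru HD HR); have [w [_ wD]] := cofinal n0 (lexx _); exists w.
have DP w : ap D w = (1 : num) -> discontinuity_at f u x e n0 w.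
  move=> E; apply: contrapT => /(HD w).2; rewrite E => E'; by case/eqP: (num_1neq0 M).
have RP w w' : ap (ap R w) w' = (1 : num) -> toQ (ap w (0 : num)) <= toQ (ap w' (0 : num)).
  rewrite -toQ_le => E L; move: E; rewrite (HR w w').2 // => E; by case/eqP: (num_1neq0 M).
have n0N : toQ N <= toQ n0 by rewrite !toQE; lra.
have cvg : converges D R u x.
  move=> d [rd [j [_ dj]]].
  (* For a later index with first term [k + 1], membership gives distance below
     [4 * eps (k + 1) = 2 * eps k] at place [k + 1]. This must be below [d_k - 2 * eps k], and
     [4 * eps k <= eps j < d_k] as [k >= j + 2]. The third successor is the shift in [closer]. *)
  pose n : num := n0 + j + 1 + 1 + 1.
  have [w [wn wD]] : exists w, ap w (0 : num) = n /\ discontinuity_at f u x e n0 w.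
    by apply: cofinal; rewrite !toQE; have := toQ_ge0 j; lra.
  exists w; split; first exact: (HD w).1.
  move=> w' [/DP [_ w'x _] /RP]; rewrite wn => /num_leP[i w'E].
  pose k : num := j + 1 + 1 + (n0 + i).
  have kE : ap w' (0 : num) = k + 1 :> num by rewrite w'E /n /k; ring.
  rewrite kE in w'x; exists k; do 2 (split; first exact: real_is_code).
  split; first exact: real_is_code.
  have jk : toQ j <= toQ k.
    by rewrite !toQE; have := toQ_ge0 i; have := toQ_ge0 N; lra.
  have := positive_tail rd dj jk; have := eps_anti (j + 1 + 1) (n0 + i); have := eps_gt0 k.
  move: w'x; rewrite -/k distrC norm_ltE epsS epsS epsS norm_ltE => -[? ?] ? ? ?; split; lra.
have [d [rd pd dE]] := exists_dyadic n0.
have [w [wD Hw]] := fx D R u netD cvg d (conj rd pd).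
have [n0w _ far] := DP w wD.
(* By reflexivity the index [w] given by convergence may be compared with itself. *)
have [k [_ [_ [_]]]] := Hw w (conj wD ((HR w w).1 (@num_lt_irr M _))).
rewrite ap_comp dE; move: n0w far; set n : num := ap w (0 : num);
  set y := ap u w => n0n far near.
have en := positive_tail re eN (le_trans n0N n0n).
have e0 : eps n0 = eps N / 2 / 2 / 2 by rewrite /n0 !epsS.
have ry : real (ap f y) by apply: rf.1 (ru w).
have rfx : real (ap f x) by apply: rf.1 rx.
have ek := eps_gt0 k; have en0 := eps_le n0n; have en0' := eps_gt0 n0.
suff : `|(ap f x)@[n + 1] - (ap f y)@[n + 1]| < 2 * eps n0 by move: far; lra.
(* The lower bound is at place [n + 1], the upper one at [k + 1]. Moving both reals between these
   places costs at most [eps n <= eps n0] if [n <= k], and otherwise [eps k], which the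
   [- 2 * eps k] in [closer] absorbs. *)
have [nk|kn] := leP (toQ n) (toQ k).
  have nk1 : toQ (n + 1) <= toQ (k + 1) by rewrite !toQE; lra.
  have := real_near ry nk1; have := real_near rfx nk1; move: near.
  by rewrite !norm_ltE epsS => -[? ?] [? ?] [? ?]; split; lra.
have kn1 : toQ (k + 1) <= toQ (n + 1) by rewrite !toQE; lra.
have := real_near ry kn1; have := real_near rfx kn1; move: near.
by rewrite !norm_ltE epsS => -[? ?] [? ?] [? ?]; split; lra.
Qed.

Theorem net_continuous_atP f x : real_fun f -> real x ->
  net_continuous_at f x <-> continuous_at f x.
Proof.
move=> rf rx; split=> [fx|fx D R u [_ [_ [_ ru]]] cvg e [re pe]].
  apply: contrapT => /existsNP[e /not_implyP[[re pe] nfx]].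
  apply: (@discontinuity_not_net_continuous f x e) => // d rd pd.
  apply: contrapT => no; apply: nfx; exists d; split=> //; split=> // y ry xy.
  by apply: contrapT => nf; apply: no; exists y.
have [d [rd [pd H]]] := fx e (conj re pe).
have [d0 [d0D Hd0]] := cvg d (conj rd pd).
exists d0; split=> // d' [d'D d0d']; rewrite ap_comp.
by apply/closer_sym/H; [apply: ru|apply/closer_sym/Hd0].
Qed.
End NetContinuity.

Local Open Scope ty_scope.
Local Open Scope tm_scope.
Local Open Scope fm_scope.

Theorem theorem4p11 :
  RCA0w_proves
    (∀ f : t1 ⟶ t1, ∀ x : t1,
       is_real_fun f↑ ⇒ is_real x ⇒
       (net_continuous f↑ x ⇔ eps_delta_continuous f↑ x)).
Proof.
apply: completeness => S axS; pose M := Model axS.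
change (sat (no_env M) (∀ f : t1 ⟶ t1, ∀ x : t1,
  is_real_fun f↑ ⇒ is_real x ⇒ (net_continuous f↑ x ⇔ eps_delta_continuous f↑ x))).
rewrite /forall_ sat_All => f; rewrite sat_All => x.
rewrite 2!sat_Imp sat_Iff sat_is_real_fun sat_is_real sat_net_continuous.
rewrite sat_eps_delta_continuous !eval_twk.
exact: net_continuous_atP.
Qed.
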